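(* Let $n\ge 1$. As an $S_n$-module, $$P_n\cong\bigoplus_{\lambda\vdash n}d_\lambda S^\lambda\ \oplus\bigoplus_{(\lambda_1,\lambda_2)\vdash n}m(\lambda_1,\lambda_2)\,S^{(\lambda_1,\lambda_2)},$$ where the second sum runs over all partitions of $n$ with at most two parts ($\lambda_1\ge\lambda_2\ge 0$, $\lambda_1+\lambda_2=n$), and $$m(\lambda_1,\lambda_2)=\begin{cases} n-2-\lambda_2, & \lambda_2\le 3,\\ n+1-2\lambda_2, & \lambda_2\ge 4,\end{cases}$$ with the value read as $0$ whenever the displayed expression is negative (which happens only for $n\le 2$).
   Context: $K$ is an algebraically closed field of characteristic $0$. A (nonassociative, non-unital) $K$-algebra is assosymmetric if $(a,b,c)=(a,c,b)=(b,a,c)$ for all its elements, where $(x,y,z)=(xy)z-x(yz)$ is the associator. The free assosymmetric algebra on a set is the quotient of the absolutely free nonassociative algebra by the ideal of all identities satisfied by every assosymmetric algebra. $P_n$ is the multilinear part of degree $n$ of the free assosymmetric algebra on $x_1,\dots,x_n$, i.e. the span of the monomials in which each $x_i$ occurs exactly once. $S_n$ acts on $P_n$ by $\tau\cdot f(x_1,\dots,x_n)=f(x_{\tau(1)},\dots,x_{\tau(n)})$. $S^\lambda$ is the Specht module (irreducible $KS_n$-module) of the partition $\lambda\vdash n$, with $S^{(n)}$ the trivial module, and $d_\lambda=\dim S^\lambda$. For a module $M$ and an integer $c\ge 0$, $cM$ means the direct sum of $c$ copies of $M$. The partition $(n)$ is regarded as $(\lambda_1,\lambda_2)=(n,0)$.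 *)

(* Defs.v *)
From HB Require Import structures.
From mathcomp Require Import all_boot all_order all_algebra all_fingroup.
From mathcomp Require Import mxrepresentation character.
From mathcomp Require Import boolp finmap monalg generic_quotient ring_quotient.

Set Implicit Arguments.
Unset Strict Implicit.
Unset Printing Implicit Defensive.

Import GRing.Theory.
Local Open Scope fset_scope.
Local Open Scope quotient_scope.
Local Open Scope ring_scope.

HB.mixin Record Lmodule_isNonAssocAlg (K : fieldType) A of GRing.Lmodule K A := {
  namul : A -> A -> A;
  namulDl : left_distributive namul +%R;
  namulDr : right_distributive namul +%R;
  namulZl : forall (k : K) x y, namul (k *: x) y = k *: namul x y;
  namulZr : forall (k : K) x y, namul x (k *: y) = k *: namul x y
}.

#[short(type="nonAssocAlgType")]
HB.structure Definition NonAssocAlg (K : fieldType) :=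
  {A of GRing.Lmodule K A & Lmodule_isNonAssocAlg K A}.

Declare Scope na_scope.
Delimit Scope na_scope with NA.
Notation "x ⋆ y" := (namul x y) (at level 40, left associativity) : na_scope.
Local Open Scope na_scope.

Section NonAssocTheory.
Variables (K : fieldType) (A : nonAssocAlgType K).
Implicit Types x y z : A.

Definition associator x y z : A := (x ⋆ y) ⋆ z - x ⋆ (y ⋆ z).

Lemma namul0x y : (0 : A) ⋆ y = 0.
Proof. by rewrite -[X in X ⋆ _](scale0r (0 : A)) namulZl scale0r. Qed.

Lemma namulx0 x : x ⋆ (0 : A) = 0.
Proof. by rewrite -[X in _ ⋆ X](scale0r (0 : A)) namulZr scale0r. Qed.

Lemma namulNl x y : (- x) ⋆ y = - (x ⋆ y).
Proof. by rewrite -scaleN1r namulZl scaleN1r. Qed.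

Lemma namulNr x y : x ⋆ (- y) = - (x ⋆ y).
Proof. by rewrite -scaleN1r namulZr scaleN1r. Qed.

Lemma namul_suml (I : Type) (r : seq I) (F : I -> A) y :
  (\sum_(i <- r) F i) ⋆ y = \sum_(i <- r) F i ⋆ y.
Proof. exact: (big_morph (namul^~ y) (fun a b => namulDl a b y) (namul0x y)). Qed.

Lemma namul_sumr (I : Type) (r : seq I) (F : I -> A) x :
  x ⋆ (\sum_(i <- r) F i) = \sum_(i <- r) x ⋆ F i.
Proof. exact: (big_morph (namul x) (namulDr x) (namulx0 x)). Qed.

End NonAssocTheory.

HB.mixin Record NonAssocAlg_isAssosym (K : fieldType) A of NonAssocAlg K A := {
  associatorA23 : forall a b c : A, associator a b c = associator a c b;
  associatorA12 : forall a b c : A, associator a b c = associator b a c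
}.

#[short(type="assosymAlgType")]
HB.structure Definition AssosymAlg (K : fieldType) :=
  {A of NonAssocAlg K A & NonAssocAlg_isAssosym K A}.

Inductive magma (X : Type) := MVar of X | MMul of magma X & magma X.

Section MagmaChoice.
Variable X : Type.

Fixpoint magma_encode (m : magma X) : GenTree.tree X :=
  match m with
  | MVar x => GenTree.Leaf x
  | MMul u v => GenTree.Node 0 [:: magma_encode u; magma_encode v]
  end.

Fixpoint magma_decode (t : GenTree.tree X) : option (magma X) :=
  match t with
  | GenTree.Leaf x => Some (MVar x)
  | GenTree.Node _ [:: t1; t2] =>
      if (magma_decode t1, magma_decode t2) is (Some u, Some v)
      then Some (MMul u v) else None
  | _ => None
  end.

Lemma magma_encodeK : pcancel magma_encode magma_decode.
Proof. by elim=> //= u -> v ->. Qed.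

Fixpoint letters (m : magma X) : seq X :=
  match m with MVar x => [:: x] | MMul u v => letters u ++ letters v end.

End MagmaChoice.

HB.instance Definition _ (X : eqType) :=
  Equality.copy (magma X) (pcan_type (@magma_encodeK X)).
HB.instance Definition _ (X : choiceType) :=
  Choice.copy (magma X) (pcan_type (@magma_encodeK X)).

Section LinearExtension.
Variables (K : fieldType) (T : choiceType) (V : lmodType K) (h : T -> V).

Definition linext (f : {malg K[T]}) : V := \sum_(u <- msupp f) f@_u *: h u.

Lemma linextEw (d : {fset T}) (f : {malg K[T]}) :
  msupp f `<=` d -> linext f = \sum_(u <- d) f@_u *: h u.
Proof.
move=> fd; apply: big_fset_incl => // u _ /mcoeff_outdom ->.
by rewrite scale0r.
Qed.

Lemma linext_is_linear : linear linext.
Proof.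
move=> k f g; set d := msupp f `|` msupp g.
have fd : msupp f `<=` d by apply: fsubsetUl.
have gd : msupp g `<=` d by apply: fsubsetUr.
have kd : msupp (k *: f + g) `<=` d.
  apply: fsubset_trans (msuppD_le _ _) _; apply: fsetSU; exact: msuppZ_le.
rewrite (linextEw fd) (linextEw gd) (linextEw kd) scaler_sumr -big_split /=.
by apply: eq_bigr => u _; rewrite mcoeffD mcoeffZ scalerDl scalerA.
Qed.

HB.instance Definition _ :=
  GRing.isLinear.Build K {malg K[T]} V *:%R linext linext_is_linear.

Lemma linextD f g : linext (f + g) = linext f + linext g.
Proof. exact: linearD. Qed.

Lemma linextZ k f : linext (k *: f) = k *: linext f.
Proof. exact: linearZ. Qed.

Lemma linextU c u : linext << c *g u >> = c *: h u.
Proof. by rewrite (linextEw msuppU_le) big_seq_fset1 mcoeffUU. Qed.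

End LinearExtension.

Section LinearExtensionTheory.
Variables (K : fieldType) (T : choiceType) (V : lmodType K).
Implicit Types (h : T -> V) (f : {malg K[T]}).

Lemma eq_linext h1 h2 f : h1 =1 h2 -> linext h1 f = linext h2 f.
Proof. by move=> eqh; apply: eq_bigr => u _; rewrite eqh. Qed.

Lemma linextDfun h1 h2 f :
  linext (fun u => h1 u + h2 u) f = linext h1 f + linext h2 f.
Proof. by rewrite -big_split; apply: eq_bigr => u _; rewrite scalerDr. Qed.

Lemma linextZfun k h f : linext (fun u => k *: h u) f = k *: linext h f.
Proof.
by rewrite scaler_sumr; apply: eq_bigr => u _; rewrite !scalerA mulrC.
Qed.

Lemma linear_linext (W : lmodType K) (phi : {linear V -> W}) h f :
  phi (linext h f) = linext (fun u => phi (h u)) f.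
Proof. by rewrite linear_sum; apply: eq_bigr => u _; rewrite linearZ. Qed.

End LinearExtensionTheory.

Definition freeNA (K : fieldType) (X : choiceType) := {malg K[magma X]}.

HB.instance Definition _ (K : fieldType) (X : choiceType) :=
  GRing.Lmodule.copy (freeNA K X) {malg K[magma X]}.

HB.lock
Definition freeNA_mul (K : fieldType) (X : choiceType) (f g : freeNA K X) :
    freeNA K X :=
  linext (fun u => linext (fun v => << MMul u v >> : freeNA K X) g) f.

Section FreeNonAssoc.
Variables (K : fieldType) (X : choiceType).
Local Notation F := (freeNA K X).
Local Notation freeNA_mul := (@freeNA_mul K X).

Lemma freeNA_mulDl : left_distributive freeNA_mul +%R.
Proof. by move=> f g h; rewrite freeNA_mul.unlock linearD. Qed.

Lemma freeNA_mulDr : right_distributive freeNA_mul +%R.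
Proof.
by move=> f g h; rewrite freeNA_mul.unlock -linextDfun;
  apply: eq_linext => u; rewrite linextD.
Qed.

Lemma freeNA_mulZl k f g : freeNA_mul (k *: f) g = k *: freeNA_mul f g.
Proof. by rewrite freeNA_mul.unlock linearZ. Qed.

Lemma freeNA_mulZr k f g : freeNA_mul f (k *: g) = k *: freeNA_mul f g.
Proof.
by rewrite freeNA_mul.unlock -linextZfun; apply: eq_linext => u; rewrite linextZ.
Qed.

HB.instance Definition _ := Lmodule_isNonAssocAlg.Build K F
  freeNA_mulDl freeNA_mulDr freeNA_mulZl freeNA_mulZr.

End FreeNonAssoc.

Section Substitution.
Variables (K : fieldType) (X : choiceType) (A : nonAssocAlgType K) (h : X -> A).

Fixpoint magma_subst (m : magma X) : A :=
  match m with
  | MVar x => h x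
  | MMul u v => magma_subst u ⋆ magma_subst v
  end.

Definition freeNA_subst (f : freeNA K X) : A := linext magma_subst f.

Lemma freeNA_subst_is_linear : linear freeNA_subst.
Proof. exact: linext_is_linear. Qed.

HB.instance Definition _ :=
  GRing.isLinear.Build K (freeNA K X) A *:%R freeNA_subst freeNA_subst_is_linear.

Lemma freeNA_substM f g :
  freeNA_subst (f ⋆ g) = freeNA_subst f ⋆ freeNA_subst g.
Proof.
rewrite {1}/namul /= freeNA_mul.unlock [LHS]linear_linext.
rewrite [X in _ = X ⋆ _]/freeNA_subst namul_suml.
apply: eq_bigr => u _; rewrite namulZl; congr (_ *: _).
rewrite [LHS]linear_linext [X in _ = _ ⋆ X]/freeNA_subst namul_sumr.
apply: eq_bigr => v _; rewrite namulZr; congr (_ *: _).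
by rewrite -[LHS]/(linext _ _) linextU scale1r.
Qed.

End Substitution.

Definition is_assosym_identity (K : fieldType) (X : choiceType)
    (f : freeNA K X) : Prop :=
  forall (A : assosymAlgType K) (h : X -> A), freeNA_subst h f = 0.

Definition assosym_identities (K : fieldType) (X : choiceType) :
  {pred freeNA K X} := fun f => `[< is_assosym_identity f >].

Section FreeAssosym.
Variables (K : fieldType) (X : choiceType).
Local Notation I := (@assosym_identities K X).

Lemma identityP f : reflect (is_assosym_identity f) (f \in I).
Proof. exact: asboolP. Qed.

Lemma identities_zmod_closed : zmod_closed I.
Proof.
split=> [|f g /identityP If /identityP Ig]; apply/identityP => A h.
  by rewrite linear0.
by rewrite linearB /= If Ig subrr.
Qed.

HB.instance Definition _ :=
  GRing.isZmodClosed.Build (freeNA K X) (@assosym_identities K X)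
    identities_zmod_closed.

Lemma identityZ k f : f \in I -> k *: f \in I.
Proof.
by move=> /identityP If; apply/identityP => A h; rewrite linearZ /= If scaler0.
Qed.

Lemma identityMl f g : f \in I -> f ⋆ g \in I.
Proof.
by move=> /identityP If; apply/identityP => A h; rewrite freeNA_substM If namul0x.
Qed.

Lemma identityMr f g : g \in I -> f ⋆ g \in I.
Proof.
by move=> /identityP Ig; apply/identityP => A h; rewrite freeNA_substM Ig namulx0.
Qed.

Definition freeAssosym := Quotient.quot I.
Local Notation Q := freeAssosym.

HB.instance Definition _ := GRing.Zmodule.on Q.
HB.instance Definition _ := Quotient.on Q.

Lemma freeAssosymE f g : (\pi_Q f = \pi_Q g) <-> (f - g \in I).
Proof. by rewrite (Quotient.idealrBE I); split=> [->|/eqP]. Qed.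

Lemma freeAssosym_reprP f : repr (\pi_Q f) - f \in I.
Proof. by apply/freeAssosymE; rewrite reprK. Qed.

Variant freeAssosym_spec : Q -> Type :=
  FreeAssosymSpec f : freeAssosym_spec (\pi_Q f).

Lemma freeAssosymP x : freeAssosym_spec x.
Proof. by have := FreeAssosymSpec (repr x); rewrite reprK. Qed.

Lemma freeAssosym_piB f g : \pi_Q (f - g) = \pi_Q f - \pi_Q g.
Proof. exact: (raddfB \pi_(Quotient.quot I)). Qed.

Lemma freeAssosym_piD f g : \pi_Q (f + g) = \pi_Q f + \pi_Q g.
Proof. exact: (raddfD \pi_(Quotient.quot I)). Qed.

Definition freeAssosym_scale (k : K) (x : Q) : Q := \pi_Q (k *: repr x).
Definition freeAssosym_mul (x y : Q) : Q := \pi_Q (repr x ⋆ repr y).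

Lemma pi_scale k f : freeAssosym_scale k (\pi_Q f) = \pi_Q (k *: f).
Proof.
by apply/freeAssosymE; rewrite -scalerBr identityZ // freeAssosym_reprP.
Qed.

Lemma pi_mul f g : freeAssosym_mul (\pi_Q f) (\pi_Q g) = \pi_Q (f ⋆ g).
Proof.
apply/freeAssosymE; set f' := repr _; set g' := repr _.
have -> : f' ⋆ g' - f ⋆ g = (f' - f) ⋆ g' + f ⋆ (g' - g).
  by rewrite namulDl namulDr namulNl namulNr addrA subrK.
by apply: rpredD; [apply: identityMl | apply: identityMr];
  apply: freeAssosym_reprP.
Qed.

Lemma freeAssosym_scaleA a b x :
  freeAssosym_scale a (freeAssosym_scale b x) = freeAssosym_scale (a * b) x.
Proof. by case: (freeAssosymP x) => {}x; rewrite !pi_scale scalerA. Qed.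

Lemma freeAssosym_scale1 : left_id 1 freeAssosym_scale.
Proof. by move=> x; case: (freeAssosymP x) => {}x;
  rewrite pi_scale scale1r. Qed.

Lemma freeAssosym_scaleDr : right_distributive freeAssosym_scale +%R.
Proof.
move=> a x y; case: (freeAssosymP x) => {}x; case: (freeAssosymP y) => {}y;
  rewrite -freeAssosym_piD !pi_scale.
by rewrite -freeAssosym_piD scalerDr.
Qed.

Lemma freeAssosym_scaleDl x : {morph freeAssosym_scale^~ x : a b / a + b}.
Proof.
by move=> a b; case: (freeAssosymP x) => {}x;
  rewrite !pi_scale -freeAssosym_piD scalerDl.
Qed.

HB.instance Definition _ := GRing.Zmodule_isLmodule.Build K Q
  freeAssosym_scaleA freeAssosym_scale1 freeAssosym_scaleDr freeAssosym_scaleDl.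

Lemma freeAssosym_piZ k f : \pi_Q (k *: f) = k *: \pi_Q f.
Proof. by rewrite -pi_scale. Qed.

Lemma freeAssosym_mulDl : left_distributive freeAssosym_mul +%R.
Proof.
move=> x y z; case: (freeAssosymP x) => {}x; case: (freeAssosymP y) => {}y;
  case: (freeAssosymP z) => {}z.
by rewrite -freeAssosym_piD !pi_mul -freeAssosym_piD namulDl.
Qed.

Lemma freeAssosym_mulDr : right_distributive freeAssosym_mul +%R.
Proof.
move=> x y z; case: (freeAssosymP x) => {}x; case: (freeAssosymP y) => {}y;
  case: (freeAssosymP z) => {}z.
by rewrite -freeAssosym_piD !pi_mul -freeAssosym_piD namulDr.
Qed.

Lemma freeAssosym_mulZl (k : K) (x y : Q) :
  freeAssosym_mul (k *: x) y = k *: freeAssosym_mul x y.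
Proof.
case: (freeAssosymP x) => {}x; case: (freeAssosymP y) => {}y.
by rewrite -freeAssosym_piZ !pi_mul -freeAssosym_piZ namulZl.
Qed.

Lemma freeAssosym_mulZr (k : K) (x y : Q) :
  freeAssosym_mul x (k *: y) = k *: freeAssosym_mul x y.
Proof.
case: (freeAssosymP x) => {}x; case: (freeAssosymP y) => {}y.
by rewrite -freeAssosym_piZ !pi_mul -freeAssosym_piZ namulZr.
Qed.

HB.instance Definition _ := Lmodule_isNonAssocAlg.Build K Q
  freeAssosym_mulDl freeAssosym_mulDr freeAssosym_mulZl freeAssosym_mulZr.

Lemma freeAssosym_piM f g : \pi_Q (f ⋆ g) = \pi_Q f ⋆ \pi_Q g.
Proof. by rewrite -pi_mul. Qed.

Lemma freeAssosym_piA f g h :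
  \pi_Q (associator f g h) = associator (\pi_Q f) (\pi_Q g) (\pi_Q h).
Proof.
rewrite [in LHS]/associator freeAssosym_piB.
by rewrite (freeAssosym_piM (f ⋆ g)) (freeAssosym_piM f g)
  (freeAssosym_piM f (g ⋆ h)) (freeAssosym_piM g h).
Qed.

Lemma freeNA_substA (A : nonAssocAlgType K) (s : X -> A) f g h :
  freeNA_subst s (associator f g h)
  = associator (freeNA_subst s f) (freeNA_subst s g) (freeNA_subst s h).
Proof. by rewrite /associator linearB /= !freeNA_substM. Qed.

Lemma freeAssosym_associator23 (a b c : Q) : associator a b c = associator a c b.
Proof.
case: (freeAssosymP a) => {}a; case: (freeAssosymP b) => {}b;
  case: (freeAssosymP c) => {}c; rewrite -!freeAssosym_piA.
apply/freeAssosymE/identityP => A h.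
by rewrite linearB /= !freeNA_substA associatorA23 subrr.
Qed.

Lemma freeAssosym_associator12 (a b c : Q) : associator a b c = associator b a c.
Proof.
case: (freeAssosymP a) => {}a; case: (freeAssosymP b) => {}b;
  case: (freeAssosymP c) => {}c; rewrite -!freeAssosym_piA.
apply/freeAssosymE/identityP => A h.
by rewrite linearB /= !freeNA_substA associatorA12 subrr.
Qed.

HB.instance Definition _ := NonAssocAlg_isAssosym.Build K Q
  freeAssosym_associator23 freeAssosym_associator12.

Definition freeAssosym_gen (x : X) : Q := \pi_Q (<< MVar x >> : freeNA K X).

End FreeAssosym.

(* By [assosym_subst_pi] the choice of the representative is immaterial. *)
Section AssosymSubst.
Variables (K : fieldType) (X : choiceType) (A : assosymAlgType K) (h : X -> A).
Local Notation Q := (freeAssosym K X).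

Definition assosym_subst (f : Q) : A := freeNA_subst h (repr f).

Lemma assosym_subst_pi f : assosym_subst (\pi_Q f) = freeNA_subst h f.
Proof.
have /identityP/(_ A h) := freeAssosym_reprP f.
by rewrite linearB => /eqP; rewrite subr_eq0 => /eqP.
Qed.

Lemma assosym_subst_is_linear : linear assosym_subst.
Proof.
move=> k x y; case: (freeAssosymP x) => {}x; case: (freeAssosymP y) => {}y;
  rewrite -freeAssosym_piZ -freeAssosym_piD.
by rewrite !assosym_subst_pi linearP.
Qed.

HB.instance Definition _ :=
  GRing.isLinear.Build K Q A *:%R assosym_subst assosym_subst_is_linear.

Lemma assosym_substM x y : assosym_subst (x ⋆ y) = assosym_subst x ⋆ assosym_subst y.
Proof.
case: (freeAssosymP x) => {}x; case: (freeAssosymP y) => {}y;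
  rewrite -freeAssosym_piM.
by rewrite !assosym_subst_pi freeNA_substM.
Qed.

Lemma assosym_subst_gen x : assosym_subst (freeAssosym_gen K x) = h x.
Proof. by rewrite assosym_subst_pi /freeNA_subst linextU scale1r. Qed.

End AssosymSubst.

Section Multilinear.
Variables (K : fieldType) (n : nat).
Local Notation Q := (freeAssosym K 'I_n).

Definition assosym_monomial (m : magma 'I_n) : Q :=
  magma_subst (fun i => freeAssosym_gen K i) m.

Definition multilinear_monomial (m : magma 'I_n) : bool :=
  [forall i, count_mem i (letters m) == 1%N].

Definition is_multilinear (f : Q) : Prop :=
  exists2 s : seq (K * magma 'I_n), all (fun c => multilinear_monomial c.2) s
    & f = \sum_(c <- s) c.1 *: assosym_monomial c.2.

Definition multilinear : {pred Q} := fun f => `[< is_multilinear f >].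

Lemma multilinearP f : reflect (is_multilinear f) (f \in multilinear).
Proof. exact: asboolP. Qed.

Lemma multilinear_submod_closed : submod_closed multilinear.
Proof.
split=> [|k f g /multilinearP[s sP ->] /multilinearP[t tP ->]]; apply/multilinearP.
  by exists [::]; rewrite ?big_nil.
exists ([seq (k * c.1, c.2) | c <- s] ++ t).
  by rewrite all_cat tP andbT all_map.
rewrite big_cat big_map /= scaler_sumr; congr (_ + _).
by apply: eq_bigr => c _; rewrite scalerA.
Qed.

HB.instance Definition _ :=
  GRing.isSubmodClosed.Build K Q multilinear multilinear_submod_closed.

Record multilinear_part :=
  MultilinearPart {multilinear_val :> Q; _ : multilinear_val \in multilinear}.

HB.instance Definition _ := [isSub for multilinear_val].
HB.instance Definition _ := [Choice of multilinear_part by <:].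
HB.instance Definition _ := [SubChoice_isSubLmodule of multilinear_part by <:].

(* f(x_1, ..., x_n) |-> f(x_{s 1}, ..., x_{s n}) *)
Definition perm_vars (s : 'S_n) : Q -> Q :=
  assosym_subst (fun i => freeAssosym_gen K (s i)).

Fixpoint magma_map (s : 'S_n) (m : magma 'I_n) : magma 'I_n :=
  match m with
  | MVar i => MVar (s i)
  | MMul u v => MMul (magma_map s u) (magma_map s v)
  end.

Lemma perm_vars_monomial s m :
  perm_vars s (assosym_monomial m) = assosym_monomial (magma_map s m).
Proof.
elim: m => [i|u IHu v IHv] /=; first exact: assosym_subst_gen.
rewrite -[RHS]/(assosym_monomial (magma_map s u) ⋆
  assosym_monomial (magma_map s v)).
by rewrite -IHu -IHv -assosym_substM.
Qed.

Lemma multilinear_magma_map s m :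
  multilinear_monomial m -> multilinear_monomial (magma_map s m).
Proof.
have lettersE : letters (magma_map s m) = map s (letters m).
  by elim: m => //= u -> v ->; rewrite map_cat.
move/forallP => mlin; apply/forallP => i.
rewrite lettersE count_map -(eqP (mlin (s^-1 i)%g)); apply/eqP/eq_count => j /=.
by apply/eqP/eqP => [<-|->]; rewrite ?permK ?permKV.
Qed.

Lemma perm_vars_multilinear s f :
  f \in multilinear -> perm_vars s f \in multilinear.
Proof.
move=> /multilinearP[r rP ->]; apply/multilinearP.
exists [seq (c.1, magma_map s c.2) | c <- r].
  by rewrite all_map; apply: sub_all rP => c /=; exact: multilinear_magma_map.
rewrite /perm_vars linear_sum big_map; apply: eq_bigr => c _ /=.
by rewrite linearZ /= -perm_vars_monomial.
Qed.

Definition multilinear_act (s : 'S_n) (f : multilinear_part) : multilinear_part :=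
  MultilinearPart (perm_vars_multilinear s (valP f)).

End Multilinear.

(* A partition of n is padded with zeros to length n, and the parts are
   numbered from 0: [part lam 0] is $\lambda_1$. *)
Section Partitions.
Variable n : nat.

Record intpart := IntPart {
  parts :> n.-tuple 'I_n.+1;
  _ : sorted geq [seq val i | i <- parts] && (sumn [seq val i | i <- parts] == n)
}.

HB.instance Definition _ := [isSub for parts].
HB.instance Definition _ := [Finite of intpart by <:].

Definition part (lam : intpart) (r : nat) : nat :=
  nth 0%N [seq val i | i <- parts lam] r.

Definition at_most_two_parts (lam : intpart) : bool := part lam 2 == 0%N.

End Partitions.

(* MathComp multiplies permutations from left to right and lets matrices act on
   row vectors by u |-> u *m rG s. A left action of S_n for the usual product
   (s t = s after t) is therefore a [mx_representation], with the same operator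
   attached to each s. *)
Section Specht.
Variables (K : fieldType) (n : nat).

Definition relabel (C : Type) (s : 'S_n) (t : {ffun 'I_n -> C}) :
  {ffun 'I_n -> C} := [ffun j => t ((s^-1)%g j)].

Lemma relabel1 C (t : {ffun 'I_n -> C}) : relabel 1%g t = t.
Proof. by apply/ffunP => j; rewrite ffunE invg1 perm1. Qed.

Lemma relabelM C s1 s2 (t : {ffun 'I_n -> C}) :
  relabel (s1 * s2)%g t = relabel s2 (relabel s1 t).
Proof. by apply/ffunP => j; rewrite !ffunE invMg permM. Qed.

(* The permutation module on the maps "entry |-> row"; the maps coming from
   tableaux of shape lambda are the lambda-tabloids, and they span the
   permutation module $M^\lambda$. *)
Local Notation T := {ffun 'I_n -> 'I_n}.

Definition tabloid_vec (f : T) : 'rV[K]_#|T| := delta_mx 0 (enum_rank f).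

Definition tabloid_mx (s : 'S_n) : 'M[K]_#|T| :=
  \matrix_i tabloid_vec (relabel s (enum_val i)).

Lemma tabloid_vecM f s : tabloid_vec f *m tabloid_mx s = tabloid_vec (relabel s f).
Proof. by rewrite -rowE rowK enum_rankK. Qed.

Lemma tabloid_mx_repr : mx_repr [set: 'S_n] tabloid_mx.
Proof.
have eqM A B : (forall f, tabloid_vec f *m A = tabloid_vec f *m B) -> A = B.
  move=> eqAB; apply/row_matrixP => i.
  by rewrite !rowE -(enum_valK i); apply: eqAB.
split=> [|s1 s2 _ _]; apply: eqM => f.
  by rewrite tabloid_vecM relabel1 mulmx1.
by rewrite mulmxA !tabloid_vecM relabelM.
Qed.

Definition tabloid_repr : mx_representation K [set: 'S_n] #|T| :=
  MxRepresentation tabloid_mx_repr.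

(* A tableau of shape lam sends an entry to its cell (row, column); injectivity
   suffices for a bijection onto the n cells of the diagram. *)
Definition is_tableau (lam : intpart n) (t : {ffun 'I_n -> 'I_n * 'I_n}) : bool :=
  injectiveb t && [forall i, (t i).2 < part lam (t i).1]%N.

Definition tabloid (t : {ffun 'I_n -> 'I_n * 'I_n}) : T := [ffun i => (t i).1].

Definition col_stab (t : {ffun 'I_n -> 'I_n * 'I_n}) : {set 'S_n} :=
  [set s : 'S_n | [forall i, (t (s i)).2 == (t i).2]].

Definition polytabloid (t : {ffun 'I_n -> 'I_n * 'I_n}) : 'rV[K]_#|T| :=
  \sum_(s in col_stab t) (-1) ^+ s *: tabloid_vec (tabloid (relabel s t)).

Definition specht_mx (lam : intpart n) : 'M[K]_#|T| :=
  (\sum_(t | is_tableau lam t) <<polytabloid t>>)%MS.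

Lemma relabel_tableau lam s t : is_tableau lam t -> is_tableau lam (relabel s t).
Proof.
case/andP => /injectiveP inj_t /forallP tP; apply/andP; split.
  by apply/injectiveP => i j; rewrite !ffunE => /inj_t /perm_inj.
by apply/forallP => i; rewrite ffunE.
Qed.

Lemma tabloid_relabel s t : tabloid (relabel s t) = relabel s (tabloid t).
Proof. by apply/ffunP => j; rewrite !ffunE. Qed.

Lemma polytabloidM t s : polytabloid t *m tabloid_mx s = polytabloid (relabel s t).
Proof.
rewrite /polytabloid mulmx_suml (reindex_inj (conjg_inj (s^-1)%g)) /=.
apply: eq_big => [u|u _].
  rewrite !inE; apply/forallP/forallP => uP i.
    have /eqP := uP ((s^-1)%g i).
    by rewrite !ffunE conjgE invgK !permM !permKV => ->.
  have /eqP := uP (s i).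
  by rewrite !ffunE conjgE invgK !permM permK => ->.
rewrite -scalemxAl tabloid_vecM odd_permJ; congr (_ *: tabloid_vec _).
rewrite -tabloid_relabel -!relabelM; congr (tabloid (relabel _ _)).
by rewrite conjgE invgK !mulgA mulgKV.
Qed.

Lemma specht_module lam : mxmodule tabloid_repr (specht_mx lam).
Proof.
apply/mxmoduleP => s _; rewrite sumsmxMr; apply/sumsmx_subP => t tP.
rewrite (eqmxMr _ (genmxE _)) polytabloidM.
by apply: sumsmx_sup (relabel_tableau s tP) _; rewrite genmxE.
Qed.

Definition specht (lam : intpart n) : representation K [set: 'S_n] :=
  Representation (submod_repr (specht_module lam)).

End Specht.

Definition repr_iso (K : fieldType) (gT : finGroupType) (G : {group gT})
    (V : lmodType K) (act : gT -> V -> V) (rG : representation K G) : Prop :=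
  exists f : {linear V -> 'rV[K]_(rdegree rG)},
    bijective f /\ (forall s v, s \in G -> f (act s v) = f v *m rG s).

(* Truncated subtraction: the value is 0 whenever the integer is negative. *)
Definition two_row_mult (n l2 : nat) : nat :=
  if (l2 <= 3)%N then (n - 2 - l2)%N else (n + 1 - 2 * l2)%N.

(* Main.v *)
Require Import Defs.
From HB Require Import structures.
From mathcomp Require Import all_boot all_order all_algebra all_fingroup.
From mathcomp Require Import mxrepresentation character.
From mathcomp Require Import pgroup zify ring.
Import GRing.Theory.

(* Write <x, y, z> for the associator and D_x = R_x - L_x. In characteristic
   other than 2 and 3 the assosymmetric identities imply
     <xy, z, w> = x<y, z, w> + <x, z, w>y,   D_w <x, y, z> = D_x <w, y, z>,
   and all multiplication operators commute on the ideal generated by the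
   associators, whose multilinear part is therefore spanned by the elements
     e_S = (prod_(i notin S) L_i) (prod_(i in S - {a, b, c}) D_i) <x_a, x_b, x_c>,
   one for each set S of at least three letters. Together with the left-normed
   words they span P_n, and they are independent: the words are separated by
   matrix units, the e_S by a three-dimensional assosymmetric algebra. So P_n is
   the sum of the regular module and of the permutation module on the subsets of
   size at least 3.

   To decompose such a module, let each partition act through the product of the
   column antisymmetrizer and the row symmetrizer of a tableau. Its rank is 1 on
   the corresponding Specht module and 0 on the others; as there are at least as
   many partitions as conjugacy classes, these ranks are the multiplicities. On
   the k-subsets the rank is 1 for (n - j, j) with j <= k <= n - j, and 0
   otherwise. *)

(** Both families of generators are permuted by S_n. Renaming the letters of a left-normed word
    gives such a word, and e_S depends on S alone: the associator is symmetric, the operators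
    commute, and D_w <x, y, z> = D_x <w, y, z> makes the choice of the three letters inside the
    associator immaterial. The lower bound 3 on the size of S is the number of letters of an
    associator.

    Ranks serve three purposes at once. An identity matrix of ranks shows that the Specht modules
    are pairwise non-isomorphic; with the count of conjugacy classes they exhaust the irreducible
    modules; and since ranks are additive over direct sums, they then read off multiplicities in any
    module.

    The case distinction in the multiplicity comes from counting sizes: (n - j, j) occurs once for
    every k with max(3, j) <= k <= n - j, that is n - 2 - j or n + 1 - 2j times according to which
    of 3 and j is larger. *)

Set Implicit Arguments.
Unset Strict Implicit.
Unset Printing Implicit Defensive.

Local Open Scope ring_scope.
Local Open Scope na_scope.

(** * Consequences of the assosymmetric identities *)

(* Square-zero extension of the integers by V; embedding V into this commutative
   ring lets [ring] decide equalities in an abelian group. *)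
Definition trivext (V : zmodType) : Type := int * V.

Section TrivialExtension.
Variable V : zmodType.

HB.instance Definition _ := GRing.Zmodule.on (trivext V).

Definition trivext_mul (a b : trivext V) : trivext V :=
  (a.1 * b.1, b.2 *~ a.1 + a.2 *~ b.1).

Fact trivext_mulA : associative trivext_mul.
Proof.
case=> [a u] [b v] [c w]; rewrite /trivext_mul /= mulrA; congr (_, _).
by rewrite !mulrzDl -!mulrzA addrA ![_ * a]mulrC.
Qed.
Fact trivext_mulC : commutative trivext_mul.
Proof. by case=> [a u] [b v]; rewrite /trivext_mul /= mulrC addrC. Qed.
Fact trivext_mul1 : left_id ((1, 0) : trivext V) trivext_mul.
Proof. by case=> [a u]; rewrite /trivext_mul /= mul1r mul0rz addr0. Qed.
Fact trivext_mulDl : left_distributive trivext_mul +%R.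
Proof.
case=> [a u] [b v] [c w]; rewrite /trivext_mul /= mulrDl; congr (_, _).
by rewrite !mulrzDl mulrzDr addrACA.
Qed.
Fact trivext_nz : (1, 0) != 0 :> trivext V. Proof. by []. Qed.

HB.instance Definition _ := GRing.Zmodule_isComNzRing.Build (trivext V)
  trivext_mulA trivext_mulC trivext_mul1 trivext_mulDl trivext_nz.

Definition trivext_in (u : V) : trivext V := (0, u).
Fact trivext_in_additive : zmod_morphism trivext_in.
Proof. by move=> u v; congr (_, _). Qed.
HB.instance Definition _ :=
  GRing.isZmodMorphism.Build V (trivext V) trivext_in trivext_in_additive.

Lemma trivext_in_inj : injective trivext_in.
Proof. by move=> u v []. Qed.

End TrivialExtension.


Ltac zmod := apply: trivext_in_inj; ring.

Lemma sub_eq (V : zmodType) (a b u v : V) : a = b -> u - v = a - b -> u = v.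
Proof. by move=> ->; rewrite subrr => /eqP; rewrite subr_eq0 => /eqP. Qed.

Lemma eqD (V : zmodType) (a b c d : V) : a = b -> c = d -> a + c = b + d.
Proof. by move=> -> ->. Qed.

Section Identities.
Variables (K : fieldType) (A : assosymAlgType K).
Hypotheses (K2 : 2%:R != 0 :> K) (K3 : 3%:R != 0 :> K).
Implicit Types a b c u v w x y z t : A.
Local Notation "⟨ x , y , z ⟩" := (associator x y z) (at level 0, format "⟨ x ,  y ,  z ⟩").

Lemma double_eq0 u : u + u = 0 -> u = 0.
Proof.
move=> uu; apply/eqP; have: 2%:R *: u == 0 by rewrite scaler_nat mulr2n uu.
by rewrite scaler_eq0 (negbTE K2).
Qed.

Lemma triple_eq0 u : u + u + u = 0 -> u = 0.
Proof.
move=> uu; apply/eqP; have: 3%:R *: u == 0 by rewrite scaler_nat !mulrS addr0 addrA uu.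
by rewrite scaler_eq0 (negbTE K3).
Qed.

Lemma asC12 a b c : ⟨a, b, c⟩ = ⟨b, a, c⟩. Proof. exact: associatorA12. Qed.
Lemma asC23 a b c : ⟨a, b, c⟩ = ⟨a, c, b⟩. Proof. exact: associatorA23. Qed.
Lemma asC13 a b c : ⟨a, b, c⟩ = ⟨c, b, a⟩. Proof. by rewrite asC12 asC23 asC12. Qed.
Lemma asC_rot a b c : ⟨a, b, c⟩ = ⟨b, c, a⟩. Proof. by rewrite asC12 asC23. Qed.
Lemma asC_rotV a b c : ⟨a, b, c⟩ = ⟨c, a, b⟩. Proof. by rewrite asC23 asC12. Qed.

Lemma associatorE a b c : ⟨a, b, c⟩ = (a ⋆ b) ⋆ c - a ⋆ (b ⋆ c).
Proof. by []. Qed.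

Ltac assort a b c :=
  rewrite ?(asC23 a c b) ?(asC12 b a c) ?(asC13 c b a) ?(asC_rotV b c a)
    ?(asC_rot c a b).

Lemma associatorBl a b y z : ⟨a - b, y, z⟩ = ⟨a, y, z⟩ - ⟨b, y, z⟩.
Proof. by rewrite /associator !namulDl !namulNl; zmod. Qed.

(** Holds in every nonassociative algebra by expansion. It is the only source of relations in degree
    four. *)
Lemma teichmuller w x y z :
  ⟨w ⋆ x, y, z⟩ - ⟨w, x ⋆ y, z⟩ + ⟨w, x, y ⋆ z⟩ = w ⋆ ⟨x, y, z⟩ + ⟨w, x, y⟩ ⋆ z.
Proof.
by rewrite /associator !namulDl !namulDr !namulNl !namulNr; zmod.
Qed.

Definition commutator x y : A := x ⋆ y - y ⋆ x.
Local Notation "⟦ x , y ⟧" := (commutator x y) (at level 0, format "⟦ x ,  y ⟧").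

Definition leibniz_defect x y z w := ⟨x ⋆ y, z, w⟩ - x ⋆ ⟨y, z, w⟩ - ⟨x, z, w⟩ ⋆ y.
Local Notation f := leibniz_defect.

Lemma leibniz_defectC x y z w : f x y z w = f x y w z.
Proof. by rewrite /f (asC23 _ z w) (asC23 y z w) (asC23 x z w). Qed.

(* Permuting the four letters gives a linear system for the twelve defects and the
   four commutators. Away from characteristics 2 and 3 its solutions have all
   defects zero and all commutators equal. *)
Lemma teichmuller_defect w x y z :
  f w x y z - f x y w z + f y z w x + ⟦⟨w, y, z⟩, x⟧ - ⟦⟨w, x, z⟩, y⟧ = 0.
Proof.
apply: (sub_eq (teichmuller w x y z)).
rewrite /f /commutator; assort (x ⋆ y) w z; assort (w ⋆ x) y z; assort (y ⋆ z) w x.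
by assort w x y; assort w x z; assort w y z; assort x y z; zmod.
Qed.

Lemma leibniz_defect_pair w x y z :
  f z w x y + f w x y z = ⟦⟨w, x, y⟩, z⟧ - ⟦⟨w, y, z⟩, x⟧.
Proof.
apply: (sub_eq (eqD (teichmuller_defect w x y z) (teichmuller_defect x y z w))).
rewrite (leibniz_defectC z w x y) (leibniz_defectC x y z w) (leibniz_defectC y z w x).
by assort w x y; assort w x z; assort w y z; assort x y z; zmod.
Qed.

(** Two instances of [leibniz_defect_pair] minus one of [teichmuller_defect] cancel all defects but
    one, which is left with coefficient 3. *)
Lemma leibniz_defect_triple w x y z :
  f x y w z + f x y w z + f x y w z
  = ⟦⟨x, y, z⟩, w⟧ - ⟦⟨w, x, y⟩, z⟧ + ⟦⟨w, y, z⟩, x⟧ *+ 2 - ⟦⟨w, x, z⟩, y⟧ *+ 2.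
Proof.
apply: (sub_eq (eqD (eqD (leibniz_defect_pair x y z w) (leibniz_defect_pair y z w x))
  (esym (teichmuller_defect w x y z)))).
rewrite (leibniz_defectC x y w z) (leibniz_defectC y z w x) (leibniz_defectC w x y z).
by assort w x y; assort w x z; assort w y z; assort x y z; zmod.
Qed.

(** The left side of [leibniz_defect_triple] is symmetric in w and z. Exchanging them on the right
    changes it by twice the difference of these two commutators. *)
Lemma commutator_associatorC x y z w : ⟦⟨x, y, z⟩, w⟧ = ⟦⟨x, y, w⟩, z⟧.
Proof.
apply/eqP; rewrite -subr_eq0; apply/eqP/double_eq0.
have h := leibniz_defect_triple z x y w; rewrite leibniz_defectC in h.
apply: (sub_eq (etrans (esym (leibniz_defect_triple w x y z)) h)).
by assort w x y; assort w x z; assort w y z; assort x y z; zmod.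
Qed.

(** Once the four commutators agree, their coefficients 1, -1, 2, -2 in [leibniz_defect_triple] add
    up to zero. *)
Lemma associatorMl x y z w : ⟨x ⋆ y, z, w⟩ = x ⋆ ⟨y, z, w⟩ + ⟨x, z, w⟩ ⋆ y.
Proof.
suff: f x y z w = 0 by move=> h; apply: (sub_eq h); rewrite /f; zmod.
apply: triple_eq0; rewrite leibniz_defectC leibniz_defect_triple.
have -> : ⟦⟨w, x, y⟩, z⟧ = ⟦⟨x, y, z⟩, w⟧ by rewrite asC_rot commutator_associatorC.
have -> : ⟦⟨w, y, z⟩, x⟧ = ⟦⟨x, y, z⟩, w⟧.
  by rewrite asC_rot commutator_associatorC -asC_rot.
have -> : ⟦⟨w, x, z⟩, y⟧ = ⟦⟨x, y, z⟩, w⟧.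
  by rewrite asC_rot commutator_associatorC asC23.
by zmod.
Qed.

Lemma associatorMm x y z w : ⟨z, x ⋆ y, w⟩ = x ⋆ ⟨z, y, w⟩ + ⟨z, x, w⟩ ⋆ y.
Proof. by rewrite asC12 associatorMl !(asC12 z). Qed.

Lemma associatorMr x y z w : ⟨z, w, x ⋆ y⟩ = x ⋆ ⟨z, w, y⟩ + ⟨z, w, x⟩ ⋆ y.
Proof. by rewrite asC23 associatorMm !(asC23 z w). Qed.

(** * Vanishing of iterated associators and of products of associators *)

Local Notation b x y t z w := ⟨⟨x, y, t⟩, z, w⟩.

(* As a function of the outer pair {z, w}, the iterated associator is fixed by the
   adjacency operator of the Petersen graph. Since 1 is an eigenvalue of that graph,
   [commutator_mul_associator] is needed as well to conclude that it vanishes. *)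
Lemma associator2_sum x y t z w :
  b x y t z w = b t z w x y + b y z w x t + b x z w y t.
Proof.
have e1 := associatorMl (x ⋆ y) t z w.
have e2 := associatorMl x (y ⋆ t) z w.
rewrite (associatorMl x y) (namulDl (x ⋆ _)) in e1.
rewrite (associatorMl y t) (namulDr x (y ⋆ _)) in e2.
have -> : b x y t z w = ⟨(x ⋆ y) ⋆ t, z, w⟩ - ⟨x ⋆ (y ⋆ t), z, w⟩.
  by rewrite /associator !(namulDl, namulNl); zmod.
rewrite {}e1 {}e2.
rewrite (asC_rot ⟨t, z, w⟩) (asC12 ⟨y, z, w⟩).
by rewrite (associatorE x y) (associatorE x ⟨y, z, w⟩) (associatorE ⟨x, z, w⟩); zmod.
Qed.

(** The associator of x y, z t and w is expanded by the derivation rule in two orders, the product x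
    y first or the product z t first; the two results are compared. *)
Lemma commutator_mul_associator x z y t w :
  ⟦x, z⟧ ⋆ ⟨y, t, w⟩ + ⟨x, z, w⟩ ⋆ ⟦t, y⟧ = b y z w x t - b x t w z y.
Proof.
have e1 := associatorMl x y (z ⋆ t) w.
rewrite (associatorMm z t y w) (associatorMm z t x w) in e1.
rewrite (namulDr x (z ⋆ _)) (namulDl (z ⋆ _)) in e1.
have e2 := associatorMm z t (x ⋆ y) w.
rewrite (associatorMl x y t w) (associatorMl x y z w) in e2.
rewrite (namulDr z (x ⋆ _)) (namulDl (x ⋆ _)) in e2.
have e3 := asC12 x z ⟨y, t, w⟩; have e4 := asC23 ⟨x, z, w⟩ t y.
rewrite !(associatorE _ _ ⟨y, t, w⟩) in e3; rewrite !(associatorE ⟨x, z, w⟩) in e4.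
apply: (sub_eq (eqD (eqD e3 (esym e4)) (etrans (esym e1) e2))).
rewrite (asC12 ⟨y, z, w⟩) (asC12 ⟨x, t, w⟩) (associatorE x ⟨y, z, w⟩) (associatorE z ⟨x, t, w⟩).
rewrite {1 2}/commutator (namulDl (x ⋆ z)) namulNl (namulDr _ (t ⋆ y)) namulNr.
by zmod.
Qed.

(** The effect of exchanging an inner letter with an outer one. Its vanishing makes the iterated
    associator symmetric in all five letters. *)
Let shift x z r p q := b z p q x r - b x p q z r.

Let shiftC x z r p q : shift x z r p q = shift x z r q p.
Proof. by rewrite /shift (asC23 z) (asC23 x). Qed.

(** In [commutator_mul_associator] the first product is symmetric and the second antisymmetric in y
    and t, so adding the instance with y and t exchanged removes the second. *)
Let commutator_mul_associator2 x z y t w :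
  (⟦x, z⟧ ⋆ ⟨y, t, w⟩) *+ 2 = shift x z t y w + shift x z y t w.
Proof.
have e1 := commutator_mul_associator x z y t w.
have := commutator_mul_associator x z t y w; rewrite (asC12 t y w) => e2.
have e3 : ⟦y, t⟧ = - ⟦t, y⟧ by rewrite /commutator opprB.
rewrite e3 namulNr in e2.
apply: (sub_eq (eqD e1 e2)); rewrite /shift; by assort z y w; assort z t w; zmod.
Qed.

Let shift_sum x z y t w : shift x z w y t + shift x z y t w + shift x z t y w = 0.
Proof.
have e1 := associator2_sum x y t z w; have e2 := associator2_sum z y t x w.
apply: (sub_eq (eqD (esym e1) e2)); rewrite /shift.
by assort z t w; assort z y w; assort x t w; assort x y w; assort x z w; zmod.
Qed.

(** The left side of [commutator_mul_associator2] is symmetric in y, t, w. This forces [shift] to be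
    symmetric in its last three arguments, and [shift_sum] becomes three times a single value. *)
Let shift_eq0 x z y t w : shift x z y t w = 0.
Proof.
have e y1 y2 y3 : shift x z y2 y1 y3 = shift x z y3 y1 y2.
  have := commutator_mul_associator2 x z y1 y3 y2.
  rewrite (asC23 y1) commutator_mul_associator2 => h.
  by apply: (sub_eq h); rewrite (shiftC x z y1 y3); zmod.
apply: triple_eq0; rewrite -[RHS](shift_sum x z y t w).
by rewrite (e y w t) (shiftC x z t y w) (e w t y) (shiftC x z y w t).
Qed.

(** By full symmetry all four terms of [associator2_sum] coincide, so that a value equals three
    times itself. *)
Lemma associator2_eq0 x y t z w : b x y t z w = 0.
Proof.
have e p q r u v : b p q r u v = b u q r p v.
  by apply/eqP; rewrite -subr_eq0; apply/eqP/(shift_eq0 u p v q r).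
apply: double_eq0; have := associator2_sum x y t z w.
have -> : b t z w x y = b x y t z w.
  rewrite (asC12 t z w) (e z t w x y) (asC_rotV x t w) (asC23 _ z y) (e w x t y z).
  by rewrite (asC12 y x t) (asC23 _ w z).
have -> : b y z w x t = b x y t z w.
  rewrite (asC12 y z w) (e z y w x t) (asC_rotV x y w) (asC23 _ z t) (e w x y t z).
  by rewrite (asC_rot t x y) (asC23 _ w z).
have -> : b x z w y t = b x y t z w.
  rewrite (asC12 x z w) (e z x w y t) (asC_rotV y x w) (asC23 _ z t) (e w y x t z).
  by rewrite (asC13 t y x) (asC23 _ w z).
by move=> h; apply: (sub_eq (esym h)); zmod.
Qed.

Lemma commutator_associator_eq0 x z y t w : ⟦x, z⟧ ⋆ ⟨y, t, w⟩ = 0.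
Proof.
by apply: double_eq0; rewrite -mulr2n commutator_mul_associator2 !shift_eq0 addr0.
Qed.

Lemma associator_commutator_eq0 x z w t y : ⟨x, z, w⟩ ⋆ ⟦t, y⟧ = 0.
Proof.
have := commutator_mul_associator x z y t w.
by rewrite commutator_associator_eq0 !associator2_eq0 subrr add0r.
Qed.

(** Each use of [sw] exchanges two letters of one factor with two of the other and changes the sign.
    The product of the associators on z, u, v and on w, x, y is reached by two exchanges and also by
    one, hence with both signs. *)
Lemma associator_mul_eq0 x y z u v w : ⟨x, y, z⟩ ⋆ ⟨u, v, w⟩ = 0.
Proof.
have sw (p q r s i j : A) : ⟨p, q, r⟩ ⋆ ⟨s, i, j⟩ = - (⟨p, i, j⟩ ⋆ ⟨s, q, r⟩).
  have e1 := associatorMl ⟨p, q, r⟩ s i j.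
  rewrite associator2_eq0 namul0x addr0 in e1.
  have e2 := associatorMl p s q r.
  have e3 : ⟨p, q, r⟩ ⋆ s = ⟨p ⋆ s, q, r⟩ - p ⋆ ⟨s, q, r⟩ by rewrite e2; zmod.
  rewrite -e1 e3 associatorBl associator2_eq0 sub0r associatorMl.
  by rewrite associator2_eq0 namulx0 add0r.
have h1 : ⟨x, y, z⟩ ⋆ ⟨u, v, w⟩ = ⟨v, u, z⟩ ⋆ ⟨y, x, w⟩.
  by rewrite sw (asC12 x v w) (asC12 u y z) sw opprK.
have h2 : ⟨x, y, z⟩ ⋆ ⟨u, v, w⟩ = - (⟨z, u, v⟩ ⋆ ⟨w, x, y⟩).
  by rewrite (asC_rotV x y z) (asC_rotV u v w) sw.
apply: double_eq0; rewrite {1}h2 h1.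
by rewrite (asC13 v u z) (asC13 y x w) (asC23 w x y) addNr.
Qed.

(* The ideal generated by the associators consists of such elements, so that all
   multiplication operators commute on it. *)
Record annihilates_assoc a : Prop := AnnihilatesAssoc {
  associator_l : forall u v, ⟨a, u, v⟩ = 0;
  associator_mulr : forall x y z, a ⋆ ⟨x, y, z⟩ = 0;
  associator_mull : forall x y z, ⟨x, y, z⟩ ⋆ a = 0;
  commutator_mulr : forall x y, a ⋆ ⟦x, y⟧ = 0;
  commutator_mull : forall x y, ⟦x, y⟧ ⋆ a = 0
}.
Local Notation good := annihilates_assoc.

Lemma annihilates_associator x y z : good ⟨x, y, z⟩.
Proof.
by split=> *; rewrite ?associator2_eq0 ?associator_mul_eq0
  ?commutator_associator_eq0 ?associator_commutator_eq0.
Qed.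

Lemma annih_m a u v : good a -> ⟨u, a, v⟩ = 0.
Proof. by move=> ga; rewrite asC12 associator_l. Qed.

Lemma annih_r a u v : good a -> ⟨u, v, a⟩ = 0.
Proof. by move=> ga; rewrite asC13 associator_l. Qed.

Lemma annih_mulA_l a u v : good a -> (a ⋆ u) ⋆ v = a ⋆ (u ⋆ v).
Proof. by move=> /associator_l/(_ u v)/eqP; rewrite subr_eq0 => /eqP. Qed.

Lemma annih_mulA_m a u v : good a -> (u ⋆ a) ⋆ v = u ⋆ (a ⋆ v).
Proof. by move=> /(annih_m u v)/eqP; rewrite subr_eq0 => /eqP. Qed.

Lemma annih_mulA_r a u v : good a -> (u ⋆ v) ⋆ a = u ⋆ (v ⋆ a).
Proof. by move=> /(annih_r u v)/eqP; rewrite subr_eq0 => /eqP. Qed.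

Lemma annih_mulCl a u v : good a -> u ⋆ (v ⋆ a) = v ⋆ (u ⋆ a).
Proof.
move=> ga; have := commutator_mull ga u v.
by rewrite /commutator namulDl namulNl !annih_mulA_r // => /eqP; rewrite subr_eq0 => /eqP.
Qed.

Lemma annih_mulCr a u v : good a -> (a ⋆ u) ⋆ v = (a ⋆ v) ⋆ u.
Proof.
move=> ga; have := commutator_mulr ga u v.
by rewrite /commutator namulDr namulNr -!annih_mulA_l // => /eqP; rewrite subr_eq0 => /eqP.
Qed.

Lemma annih_mul a u : good a -> good (u ⋆ a).
Proof.
move=> ga; split=> [v w|x y z|x y z|x y|x y].
- by rewrite associatorMl associator_l // namulx0 add0r associator_mull.
- by rewrite annih_mulA_m // associator_mulr // namulx0.
(* The derivation rule turns this product into an associator minus a multiple of one, and [a]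
   annihilates associators. *)
- have h : ⟨x, y, z⟩ ⋆ u = ⟨x ⋆ u, y, z⟩ - x ⋆ ⟨u, y, z⟩.
    by rewrite associatorMl; zmod.
  rewrite -annih_mulA_r // h namulDl associator_mull // add0r namulNl annih_mulA_r //.
  by rewrite associator_mull // namulx0 oppr0.
- by rewrite annih_mulA_m // commutator_mulr // namulx0.
by rewrite annih_mulCl // commutator_mull // namulx0.
Qed.

Lemma annih_mull a u : good a -> good (a ⋆ u).
Proof.
move=> ga; split=> [v w|x y z|x y z|x y|x y].
- by rewrite associatorMl (associator_mulr ga) (associator_l ga) namul0x addr0.
- have h : u ⋆ ⟨x, y, z⟩ = ⟨u ⋆ x, y, z⟩ - ⟨u, y, z⟩ ⋆ x.
    by rewrite associatorMl; zmod.
  rewrite (annih_mulA_l _ _ ga) h namulDr (associator_mulr ga) add0r namulNr -(annih_mulA_l _ _ ga).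
  by rewrite (associator_mulr ga) namul0x oppr0.
- by rewrite -(annih_mulA_m _ _ ga) (associator_mull ga) namul0x.
- by rewrite annih_mulCr // commutator_mulr // namul0x.
by rewrite -(annih_mulA_m _ _ ga) (commutator_mull ga) namul0x.
Qed.

End Identities.

(** * Normal form of monomials *)

Lemma perm_adjacent_swap (T : eqType) (R : Type) (F : seq T -> R) :
  (forall s1 a b s2, F (s1 ++ [:: a, b & s2]) = F (s1 ++ [:: b, a & s2])) ->
  forall s t, perm_eq s t -> F s = F t.
Proof.
move=> swapF s t; elim: s F swapF t => [|x s IHs] F swapF t st.
  by rewrite perm_sym in st; move/perm_nilP: st => ->.
have xt : x \in t by rewrite -(perm_mem st) mem_head.
case/splitPr: xt st => t1 t2 st.
have {st} st : perm_eq s (t1 ++ t2).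
  by rewrite -(perm_cons x) (perm_trans st) // -cat_rcons -cats1 -catA perm_catCA.
have -> : F (t1 ++ x :: t2) = F (x :: t1 ++ t2).
  elim/last_ind: t1 t2 {st} => //= t1 y IHt t2.
  by rewrite cat_rcons swapF IHt cat_rcons.
by apply: (IHs (fun s => F (x :: s))) st => s1; apply: (swapF (x :: s1)).
Qed.

Section Normal.
Variables (K : fieldType) (A : assosymAlgType K).
Hypotheses (K2 : 2%:R != 0 :> K) (K3 : 3%:R != 0 :> K).
Variables (X : choiceType) (h : X -> A).
Implicit Types (x y z : X) (s t U S : seq X) (u v w : magma X) (a b : A).
Local Notation good := (@annihilates_assoc K A).
Local Notation ev := (magma_subst h).
Local Notation "⟨ x , y , z ⟩" := (associator x y z) (at level 0, format "⟨ x ,  y ,  z ⟩").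

Lemma annih0 : good 0.
Proof.
by split=> *; rewrite /associator ?namul0x ?namulx0 ?subrr.
Qed.

Lemma annihD a b : good a -> good b -> good (a + b).
Proof.
move=> ga gb; split=> [u v|x y z|x y z|x y|x y].
- have -> : ⟨a + b, u, v⟩ = ⟨a, u, v⟩ + ⟨b, u, v⟩.
    by rewrite /associator !namulDl; zmod.
  by rewrite !associator_l // addr0.
- by rewrite namulDl !associator_mulr // addr0.
- by rewrite namulDr !associator_mull // addr0.
- by rewrite namulDl !commutator_mulr // addr0.
by rewrite namulDr !commutator_mull // addr0.
Qed.

Lemma annihZ (k : K) a : good a -> good (k *: a).
Proof.
move=> ga; split=> [u v|x y z|x y z|x y|x y].
- by rewrite /associator !namulZl -scalerBr -/(associator _ _ _) associator_l // scaler0.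
- by rewrite namulZl associator_mulr // scaler0.
- by rewrite namulZr associator_mull // scaler0.
- by rewrite namulZl commutator_mulr // scaler0.
by rewrite namulZr commutator_mull // scaler0.
Qed.

Definition diff_op a x : A := a ⋆ h x - h x ⋆ a.

(** The value 0 on lists that are too short keeps [annih_core] and [assoc_core_perm] free of a size
    condition. *)
Definition assoc_core S : A :=
  if S is [:: x, y, z & T] then foldl diff_op ⟨h x, h y, h z⟩ T else 0.

Definition assoc_elt U S : A := foldr (fun x a => h x ⋆ a) (assoc_core S) U.

Lemma annih_diff a x : good a -> good (diff_op a x).
Proof.
move=> ga; rewrite /diff_op -scaleN1r.
by apply: annihD; [apply: annih_mull | apply/annihZ/annih_mul].
Qed.

Lemma diff_opC a x y : good a -> diff_op (diff_op a x) y = diff_op (diff_op a y) x.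
Proof.
move=> ga; rewrite /diff_op !namulDl !namulDr !namulNl !namulNr.
rewrite (annih_mulCr (h x) (h y)) // (annih_mulCl (h x) (h y)) //.
by rewrite !(annih_mulA_m _ _ ga); zmod.
Qed.

Lemma annih_foldl a S : good a -> good (foldl diff_op a S).
Proof. by elim: S a => //= x S IHS a ga; apply/IHS/annih_diff. Qed.

Lemma annih_core S : good (assoc_core S).
Proof.
case: S => [|x [|y [|z S]]] /=; try exact: annih0.
exact/annih_foldl/annihilates_associator.
Qed.

Lemma annih_elt U S : good (assoc_elt U S).
Proof. by elim: U => [|x U IHU] /=; [apply: annih_core | apply: annih_mul]. Qed.

Lemma assoc_core_perm S T : perm_eq S T -> assoc_core S = assoc_core T.
Proof.
move: S T; apply: perm_adjacent_swap => [[|x [|y [|z S]]]] a b T /=.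
- by case: T => //= z T; rewrite asC12.
- by rewrite asC23.
(* The swap between the last letter of the associator and the first operator. *)
- by rewrite /diff_op -/(commutator _ _) commutator_associatorC.
rewrite !foldl_cat /= diff_opC //; exact/annih_foldl/annihilates_associator.
Qed.

Lemma assoc_elt_perm U V S T : perm_eq U V -> perm_eq S T -> assoc_elt U S = assoc_elt V T.
Proof.
rewrite /assoc_elt => UV /assoc_core_perm->.
move: U V UV; apply: perm_adjacent_swap => U a b V.
rewrite !foldr_cat /= annih_mulCl //; exact: (annih_elt V T).
Qed.

Lemma diff_op_elt x U S : (2 < size S)%N ->
  diff_op (assoc_elt U S) x = assoc_elt U (rcons S x).
Proof.
move=> Sgt; elim: U => [|y U /= <-].
  by case: S Sgt => [|a [|b [|c S]]] //= _; rewrite -cats1 foldl_cat.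
have ge := annih_elt U S.
by rewrite /diff_op namulDr namulNr (annih_mulA_m _ _ ge) (annih_mulCl (h x)).
Qed.

(** The list s records the letters with their multiplicities, so that membership for a multilinear
    monomial yields only sets S and their complements. *)
Inductive assoc_span s : A -> Prop :=
| AssocSpan0 : assoc_span s 0
| AssocSpanD (c : K) U S a : perm_eq (U ++ S) s -> (2 < size S)%N ->
    assoc_span s a -> assoc_span s (c *: assoc_elt U S + a).
Local Notation inE := assoc_span.

Lemma assoc_span_annih s a : inE s a -> good a.
Proof.
elim=> [|c U S {}a _ _ _ ga]; first exact: annih0.
exact/annihD/ga/annihZ/annih_elt.
Qed.

Lemma assoc_span_perm s t a : perm_eq s t -> inE s a -> inE t a.
Proof.
move=> st; elim=> [|c U S {}a US Sgt _ IHa]; first exact: AssocSpan0.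
by apply: AssocSpanD => //; apply: perm_trans st.
Qed.

Lemma assoc_spanD s a b : inE s a -> inE s b -> inE s (a + b).
Proof.
move=> sa sb; elim: sa => [|c U S {}a US Sgt _ IHa]; first by rewrite add0r.
by rewrite -addrA; apply: AssocSpanD.
Qed.

Lemma assoc_spanN s a : inE s a -> inE s (- a).
Proof.
elim=> [|c U S {}a US Sgt _ IHa]; first by rewrite oppr0; apply: AssocSpan0.
by rewrite opprD -scaleNr; apply: AssocSpanD.
Qed.

Lemma assoc_span_mul x s a : inE s a -> inE (x :: s) (h x ⋆ a).
Proof.
elim=> [|c U S {}a US Sgt _ IHa]; first by rewrite namulx0; apply: AssocSpan0.
by rewrite namulDr namulZr; apply: (@AssocSpanD _ c (x :: U)) IHa; rewrite //= perm_cons.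
Qed.

(** Right multiplication is left multiplication plus the difference operator: the new letter joins U
    in one term and S in the other. *)
Lemma assoc_span_mulr x s a : inE s a -> inE (x :: s) (a ⋆ h x).
Proof.
elim=> [|c U S {}a US Sgt _ IHa]; first by rewrite namul0x; apply: AssocSpan0.
rewrite namulDl namulZl; have -> : assoc_elt U S ⋆ h x =
  assoc_elt (x :: U) S + assoc_elt U (rcons S x).
  by rewrite -diff_op_elt // /diff_op /=; zmod.
rewrite scalerDr -addrA; apply: AssocSpanD => //; first by rewrite /= perm_cons.
apply: AssocSpanD IHa; last by rewrite size_rcons; apply: ltnW.
by rewrite -rcons_cat perm_rcons perm_cons.
Qed.

Lemma assoc_span_ev_mul u s a : inE s a -> inE (letters u ++ s) (ev u ⋆ a).
Proof.
elim: u s a => [x|u IHu v IHv] s a sa; first exact: assoc_span_mul.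
rewrite (annih_mulA_r _ _ (assoc_span_annih sa)) [letters _]/= -catA.
exact/IHu/IHv.
Qed.

Lemma assoc_span_ev_mulr u s a : inE s a -> inE (letters u ++ s) (a ⋆ ev u).
Proof.
elim: u s a => [x|u IHu v IHv] s a sa; first exact: assoc_span_mulr.
rewrite -[ev _]/(ev u ⋆ ev v) -(annih_mulA_l _ _ (assoc_span_annih sa)).
by apply: (assoc_span_perm _ (IHv _ _ (IHu _ _ sa))); rewrite /= perm_catCA catA.
Qed.

(** The derivation rule in each of the three slots reduces to an associator of letters multiplied by
    monomials. *)
Lemma assoc_span_associator u v w :
  inE (letters u ++ letters v ++ letters w) ⟨ev u, ev v, ev w⟩.
Proof.
elim: u v w => [x|u1 IH1 u2 IH2] v w; last first.
  rewrite associatorMl //; apply: assoc_spanD; rewrite /= -catA.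
    exact: assoc_span_ev_mul.
  by apply: assoc_span_perm (assoc_span_ev_mulr _ (IH1 _ _)); rewrite perm_catCA.
elim: v w => [y|u1 IH1 u2 IH2] w; last first.
  rewrite associatorMm //; apply: assoc_spanD; rewrite /= -catA.
    apply: assoc_span_perm (assoc_span_ev_mul _ (IH2 _)).
    by rewrite -cat1s perm_catCA.
  apply: assoc_span_perm (assoc_span_ev_mulr _ (IH1 _)).
  by rewrite /= -cat1s perm_catCA perm_cons perm_catCA.
elim: w => [z|u1 IH1 u2 IH2].
  rewrite -[X in inE _ X]addr0 -[X in inE _ (X + _)]scale1r.
  exact: (@AssocSpanD _ 1 [::] [:: x; y; z]) (AssocSpan0 _).
rewrite associatorMr //; apply: assoc_spanD.
  apply: assoc_span_perm (assoc_span_ev_mul _ IH2) => /=.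
  by rewrite -[x :: y :: _]/([:: x; y] ++ _) perm_catCA.
apply: assoc_span_perm (assoc_span_ev_mulr _ IH1) => /=.
by rewrite -[x :: y :: _]/([:: x; y] ++ _) perm_catCA /= !perm_cons perm_catC.
Qed.

Definition left_normed x s : magma X := foldl (fun u y => MMul u (MVar y)) (MVar x) s.

Lemma letters_left_normed x s : letters (left_normed x s) = x :: s.
Proof.
rewrite /left_normed; elim/last_ind: s => //= s y IHs.
by rewrite foldl_rcons /= IHs cats1.
Qed.

Lemma left_normed_rcons x s y :
  left_normed x (rcons s y) = MMul (left_normed x s) (MVar y).
Proof. by rewrite /left_normed foldl_rcons. Qed.

(** Reassociating one letter at a time costs an associator of monomials, which lies in the span. *)
Lemma left_normed_mul x s y t :
  inE (x :: s ++ y :: t) (ev (left_normed x s) ⋆ ev (left_normed y t)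
                            - ev (left_normed x (s ++ y :: t))).
Proof.
elim/last_ind: t => [|t z IHt].
  by rewrite cats1 left_normed_rcons subrr; apply: AssocSpan0.
rewrite -rcons_cons -rcons_cat !left_normed_rcons /=.
set a := ev _; set b := ev _; set c := ev _.
have -> : a ⋆ (b ⋆ h z) - c ⋆ h z = (a ⋆ b - c) ⋆ h z - ⟨a, b, h z⟩.
  by rewrite /associator namulDl namulNl; zmod.
apply: assoc_spanD.
  by apply: assoc_span_perm (assoc_span_mulr z IHt); rewrite -rcons_cons perm_sym perm_rcons.
apply: assoc_spanN; have := assoc_span_associator (left_normed x s) (left_normed y t) (MVar z).
by apply: assoc_span_perm; rewrite !letters_left_normed /= -cats1 -catA.
Qed.

Lemma left_normed_span u x s : letters u = x :: s ->
  inE (x :: s) (ev u - ev (left_normed x s)).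
Proof.
elim: u x s => [z|u IHu v IHv] x s /=; first by case=> -> <-; rewrite subrr; apply: AssocSpan0.
have : letters u != [::] /\ letters v != [::].
  have nz (w : magma X) : letters w != [::].
    by elim: w => //= w1 IH1 w2 IH2; case: (letters w1) IH1.
  by rewrite !nz.
case: (letters u) IHu (assoc_span_ev_mul u) => [|x1 s1] IHu Lu []// _.
case: (letters v) IHv (assoc_span_ev_mulr v) => [|y t] IHv Rv // _ [<- <-].
have {}IHu := IHu _ _ erefl; have {}IHv := IHv _ _ erefl.
have -> : ev u ⋆ ev v - ev (left_normed x1 (s1 ++ y :: t)) =
    ev u ⋆ (ev v - ev (left_normed y t)) +
    ((ev u - ev (left_normed x1 s1)) ⋆ ev (left_normed y t) +
    (ev (left_normed x1 s1) ⋆ ev (left_normed y t) - ev (left_normed x1 (s1 ++ y :: t)))).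
  by rewrite namulDl namulDr namulNl namulNr; zmod.
apply: assoc_spanD; first exact: Lu IHv.
apply: assoc_spanD (left_normed_mul _ _ _ _).
apply: assoc_span_perm (assoc_span_ev_mulr _ IHu).
by rewrite letters_left_normed -cat_cons perm_catC.
Qed.

End Normal.

(** * Two detecting algebras *)

Definition mxalg (K : fieldType) (n : nat) := 'M[K]_n.

Section MatrixAlgebra.
Variables (K : fieldType) (n : nat).
Local Notation M := (mxalg K n).

HB.instance Definition _ := GRing.Lmodule.copy M 'M[K]_n.
Definition mxalg_mul (A B : M) : M := A *m B.
Fact mxalg_mulDl : left_distributive mxalg_mul +%R.
Proof. exact: mulmxDl. Qed.
Fact mxalg_mulDr : right_distributive mxalg_mul +%R.
Proof. exact: mulmxDr. Qed.
Fact mxalg_mulZl (k : K) (A B : M) : mxalg_mul (k *: A) B = k *: mxalg_mul A B.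
Proof. by rewrite /mxalg_mul -scalemxAl. Qed.
Fact mxalg_mulZr (k : K) (A B : M) : mxalg_mul A (k *: B) = k *: mxalg_mul A B.
Proof. by rewrite /mxalg_mul -scalemxAr. Qed.
HB.instance Definition _ := Lmodule_isNonAssocAlg.Build K M
  mxalg_mulDl mxalg_mulDr mxalg_mulZl mxalg_mulZr.

Lemma mxalg_associator (A B C : M) : associator A B C = 0.
Proof. by apply/eqP; rewrite subr_eq0; apply/eqP; rewrite /namul /= /mxalg_mul mulmxA. Qed.
Fact mxalg_associator23 (A B C : M) : associator A B C = associator A C B.
Proof. by rewrite !mxalg_associator. Qed.
Fact mxalg_associator12 (A B C : M) : associator A B C = associator B A C.
Proof. by rewrite !mxalg_associator. Qed.
HB.instance Definition _ := NonAssocAlg_isAssosym.Build K M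
  mxalg_associator23 mxalg_associator12.

End MatrixAlgebra.

Definition trialg (K : fieldType) : Type := K^o * K^o * K^o.

Section TriAlgebra.
Variable K : fieldType.
Local Notation B := (trialg K).

HB.instance Definition _ := GRing.Lmodule.copy B (K^o * K^o * K^o)%type.
Definition tri (p q a : K) : B := (p, q, a).
(* The coordinates p and q are characters and D = q - p satisfies
   D(uv) = p(u) D(v) + D(u) q(v); this makes the third coordinate of the associator
   of u, v and w equal to D(u) D(v) D(w). *)
Definition trialg_mul (u v : B) : B :=
  let: (p, q, a) := u in let: (r, s, b) := v in
  tri (p * r) (q * s) (p * b + a * s + (q - p) * (s - r)).

Lemma triD p q a r s b : tri p q a + tri r s b = tri (p + r) (q + s) (a + b).
Proof. by []. Qed.
Lemma triB p q a r s b : tri p q a - tri r s b = tri (p - r) (q - s) (a - b).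
Proof. by []. Qed.
Lemma triZ k p q a : k *: tri p q a = tri (k * p) (k * q) (k * a).
Proof. by []. Qed.
Lemma triM p q a r s b : trialg_mul (tri p q a) (tri r s b) =
  tri (p * r) (q * s) (p * b + a * s + (q - p) * (s - r)).
Proof. by []. Qed.
Variant tri_spec : B -> Type := TriSpec p q a : tri_spec (tri p q a).
Lemma triP u : tri_spec u. Proof. by case: u => [[p q] a]; apply: TriSpec. Qed.

Fact trialg_mulDl : left_distributive trialg_mul +%R.
Proof.
move=> u v w; case: (triP u) (triP v) (triP w) => p q a [p' q' a'] [p'' q'' a''].
by rewrite !(triD, triM); congr (tri _ _ _); ring.
Qed.
Fact trialg_mulDr : right_distributive trialg_mul +%R.
Proof.
move=> u v w; case: (triP u) (triP v) (triP w) => p q a [p' q' a'] [p'' q'' a''].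
by rewrite !(triD, triM); congr (tri _ _ _); ring.
Qed.
Fact trialg_mulZl (k : K) (u v : B) : trialg_mul (k *: u) v = k *: trialg_mul u v.
Proof.
case: (triP u) (triP v) => p q a [p' q' a'].
by rewrite (triZ k p q a) !triM triZ; congr (tri _ _ _); ring.
Qed.
Fact trialg_mulZr (k : K) (u v : B) : trialg_mul u (k *: v) = k *: trialg_mul u v.
Proof.
case: (triP u) (triP v) => p q a [p' q' a'].
by rewrite (triZ k p' q' a') !triM triZ; congr (tri _ _ _); ring.
Qed.
HB.instance Definition _ := Lmodule_isNonAssocAlg.Build K B
  trialg_mulDl trialg_mulDr trialg_mulZl trialg_mulZr.

Lemma tri_mul p q a r s b : tri p q a ⋆ tri r s b =
  tri (p * r) (q * s) (p * b + a * s + (q - p) * (s - r)).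
Proof. by []. Qed.

Lemma tri_associator p q a p' q' a' p'' q'' a'' :
  associator (tri p q a) (tri p' q' a') (tri p'' q'' a'')
  = tri 0 0 ((q - p) * (q' - p') * (q'' - p'')).
Proof. by rewrite /associator !tri_mul triB; congr (tri _ _ _); ring. Qed.

Fact trialg_associator23 (u v w : B) : associator u v w = associator u w v.
Proof.
case: (triP u) (triP v) (triP w) => p q a [p' q' a'] [p'' q'' a''].
by rewrite !tri_associator mulrAC.
Qed.
Fact trialg_associator12 (u v w : B) : associator u v w = associator v u w.
Proof.
case: (triP u) (triP v) (triP w) => p q a [p' q' a'] [p'' q'' a''].
by rewrite !tri_associator [(q - p) * _]mulrC.
Qed.
HB.instance Definition _ := NonAssocAlg_isAssosym.Build K B
  trialg_associator23 trialg_associator12.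

End TriAlgebra.

Section Detect.
Variables (K : fieldType) (X : choiceType).

Lemma assoc_elt_mx n (h : X -> mxalg K n) U S : assoc_elt h U S = 0.
Proof.
have core0 : assoc_core h S = 0.
  case: S => [|x [|y [|z S]]] //=; rewrite mxalg_associator.
  by elim: S => //= t S IHS; rewrite /diff_op namul0x namulx0 subrr.
by elim: U => [|x U IHU] /=; rewrite ?core0 // IHU namulx0.
Qed.

(** On elements with only a third coordinate, left multiplication by the image of x is the scalar
    [p x] and right multiplication the scalar [q x]. *)
Lemma assoc_elt_tri (p q : X -> K) U S : (2 < size S)%N ->
  assoc_elt (fun x => tri (p x) (q x) 0) U S
  = tri 0 0 (\prod_(x <- U) p x * \prod_(x <- S) (q x - p x)).
Proof.
move=> Sgt; elim: U => [|x U IHU] /=; last first.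
  by rewrite IHU tri_mul big_cons; congr (tri _ _ _); ring.
rewrite big_nil mul1r; case: S Sgt => [|x [|y [|z S]]] //= _.
rewrite !big_cons tri_associator !mulrA; move: (_ * _ * _).
elim: S => [|t S IHS] c /=; first by rewrite big_nil mulr1.
rewrite /diff_op !tri_mul triB big_cons mulrA -IHS; congr (foldl _ _ _).
by congr (tri _ _ _); ring.
Qed.

Variables (A B : assosymAlgType K) (f : {linear A -> B}).
Hypothesis fM : forall a b, f (a ⋆ b) = f a ⋆ f b.

Lemma morph_assoc_elt (h : X -> A) U S :
  f (assoc_elt h U S) = assoc_elt (f \o h) U S.
Proof.
elim: U => [|x U IHU] /=; last by rewrite fM IHU.
case: S => [|x [|y [|z S]]] /=; rewrite ?linear0 //.
have -> : associator (f (h x)) (f (h y)) (f (h z)) = f (associator (h x) (h y) (h z)).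
  by rewrite /associator linearB /= !fM.
elim: S (associator _ _ _) => //= t S IHS a; rewrite IHS; congr (foldl _ _ _).
by rewrite /diff_op linearB /= !fM.
Qed.

End Detect.

Section Words.
Variables (K : fieldType) (X : choiceType) (w : seq X).
Local Notation n := (size w).

(** The sum of the matrix units (i, i + 1) over the positions i of x in w, so that a product of such
    matrices reads a word along w. Using [take 1 (drop i w)] covers i = [size w] and needs no
    default letter. *)
Definition word_mx (x : X) : mxalg K n.+1 :=
  \matrix_(i, j) ((j == i.+1 :> nat) && (take 1 (drop i w) == [:: x]))%:R.

Lemma take_drop_cat (u v s : seq X) :
  ((u ++ v) == take (size u + size v) s) =
  (u == take (size u) s) && (v == take (size v) (drop (size u) s)).
Proof.
rewrite takeD; have [le|lt] := leqP (size u) (size s).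
  by rewrite eqseq_cat // size_takel.
have -> : (u == take (size u) s) = false.
  apply/eqP => /(congr1 size); rewrite size_take ltnNge (ltnW lt) /= => e.
  by rewrite e ltnn in lt.
rewrite take_oversize ?(ltnW lt) // drop_oversize ?(ltnW lt) // cats0.
apply/eqP => /(congr1 size); rewrite size_cat => e.
by rewrite -e ltnNge leq_addr in lt.
Qed.

Lemma word_mx_subst u (i j : 'I_n.+1) :
  magma_subst word_mx u i j =
  ((j == i + size (letters u) :> nat)%N &&
   (letters u == take (size (letters u)) (drop i w)))%:R.
Proof.
elim: u i j => [x|u IHu v IHv] i j; first by rewrite /= !mxE addn1 [[:: x] == _]eq_sym.
rewrite -[magma_subst _ _]/(magma_subst word_mx u *m magma_subst word_mx v) mxE.
rewrite /= size_cat take_drop_cat drop_drop.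
have [lt|ge] := ltnP (i + size (letters u))%N n.+1; last first.
  rewrite big1 => [|k _]; last first.
    by rewrite IHu (ltn_eqF (leq_trans (ltn_ord k) ge)) mul0r.
  rewrite addnA (ltn_eqF (leq_trans (ltn_ord j) _)) //.
  by rewrite (leq_trans ge) // leq_addr.
rewrite (bigD1 (Ordinal lt)) //= big1 ?addr0 => [|k nk]; last first.
  rewrite IHu; case: eqP => [e|_]; last by rewrite mul0r.
  by case/eqP: nk; apply: val_inj.
rewrite IHu IHv /= eqxx /= -natrM mulnb addnA; congr (_%:R).
by rewrite [(_ + i)%N]addnC; case: (_ == _); rewrite ?andbF ?andbT.
Qed.

Lemma word_mx_coord u : magma_subst word_mx u ord0 ord_max = (letters u == w)%:R.
Proof.
rewrite word_mx_subst /= add0n drop0; congr (_%:R).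
case: (eqVneq n (size (letters u))) => [e|ne] /=; first by rewrite -e take_size.
by case: eqP => // e; rewrite e eqxx in ne.
Qed.

End Words.

(** * The multilinear part as a permutation module *)

Section PermutationModule.
Variables (K : fieldType) (gT : finGroupType) (T : finType) (act : T -> gT -> T).
Hypotheses (act1 : forall x, act x 1%g = x)
  (actM : forall x s t, act x (s * t)%g = act (act x s) t).

Definition perm_module_mx (s : gT) : 'M[K]_#|T| :=
  \matrix_i delta_mx 0 (enum_rank (act (enum_val i) s)).

Lemma delta_perm_module x s :
  delta_mx 0 (enum_rank x) *m perm_module_mx s = delta_mx 0 (enum_rank (act x s)) :> 'rV_#|T|.
Proof. by rewrite -rowE rowK enum_rankK. Qed.

Lemma perm_module_repr_proof : mx_repr [set: gT] perm_module_mx.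
Proof.
split=> [|s t _ _]; apply/row_matrixP => i; rewrite !rowE -(enum_valK i).
  by rewrite delta_perm_module act1 mulmx1.
by rewrite mulmxA !delta_perm_module actM.
Qed.

Definition perm_module : mx_representation K [set: gT] #|T| :=
  MxRepresentation perm_module_repr_proof.

Lemma mul_perm_module (v : 'rV[K]_#|T|) s x :
  (v *m perm_module s) 0 (enum_rank (act x s)) = v 0 (enum_rank x).
Proof.
have act_inj : injective (act^~ s).
  by move=> y z e; rewrite -(act1 y) -(mulgV s) actM e -actM mulgV act1.
rewrite mxE (bigD1 (enum_rank x)) //= !mxE enum_rankK !eqxx mulr1 big1 ?addr0 //.
move=> j nj; rewrite !mxE eqxx /= (inj_eq enum_rank_inj).
case: eqP => [/act_inj e|_]; last by rewrite mulr0.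
by case/eqP: nj; rewrite e enum_valK.
Qed.

End PermutationModule.

Lemma perm_enum_setC n (S : {set 'I_n}) :
  perm_eq (enum S ++ enum (~: S)) (enum 'I_n).
Proof.
apply: uniq_perm; rewrite ?enum_uniq //.
  rewrite cat_uniq !enum_uniq andbT /=; apply/hasPn => x.
  by rewrite !mem_enum inE.
by move=> x; rewrite mem_cat !mem_enum inE orbN.
Qed.

Lemma linear_combP (K : fieldType) (V : lmodType K) (I : finType) (F : I -> V)
    (k : K) (c d : I -> K) :
  \sum_i (k * c i + d i) *: F i = k *: (\sum_i c i *: F i) + \sum_i d i *: F i.
Proof.
rewrite scaler_sumr -big_split; apply: eq_bigr => i _.
by rewrite scalerDl scalerA.
Qed.

Lemma linear_comb2P (K : fieldType) (V : lmodType K) (I J : finType) (F : I -> V) (G : J -> V)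
    (k : K) (c c' : I -> K) (d d' : J -> K) :
  k *: (\sum_i c i *: F i + \sum_j d j *: G j) + (\sum_i c' i *: F i + \sum_j d' j *: G j) =
  \sum_i (k * c i + c' i) *: F i + \sum_j (k * d j + d' j) *: G j.
Proof. by rewrite !linear_combP scalerDr addrACA. Qed.

Section Multi.
Variables (K : fieldType) (n : nat).
Hypotheses (K2 : 2%:R != 0 :> K) (K3 : 3%:R != 0 :> K) (n_gt0 : (0 < n)%N).
Local Notation Q := (freeAssosym K 'I_n).
Local Notation P := (multilinear_part K n).
Local Notation gen := (@freeAssosym_gen K 'I_n).
Local Notation ev := (magma_subst gen).

Lemma multilinear_monomialE (u : magma 'I_n) :
  multilinear_monomial u = perm_eq (letters u) (enum 'I_n).
Proof.
apply/forallP/idP => [h|/seq.permP h i]; last first.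
  by rewrite h count_uniq_mem ?enum_uniq // mem_enum.
apply: uniq_perm; rewrite ?enum_uniq //.
  apply: count_mem_uniq => i; rewrite (eqP (h i)).
  by rewrite -has_pred1 has_count (eqP (h i)).
by move=> i; rewrite mem_enum -has_pred1 has_count (eqP (h i)).
Qed.

Definition monomial_span (s : seq 'I_n) (a : Q) : Prop :=
  exists2 r : seq (K * magma 'I_n), all (fun c => perm_eq (letters c.2) s) r
    & a = \sum_(c <- r) c.1 *: ev c.2.

Lemma monomial_span1 u : monomial_span (letters u) (ev u).
Proof. by exists [:: (1, u)]; rewrite /= ?perm_refl // big_seq1 scale1r. Qed.

Lemma monomial_spanB s a b :
  monomial_span s a -> monomial_span s b -> monomial_span s (a - b).
Proof.
move=> [r rs ->] [t ts ->]; exists (r ++ [seq (- c.1, c.2) | c <- t]).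
  by rewrite all_cat rs all_map.
rewrite big_cat big_map /= -sumrN; congr (_ + _).
by apply: eq_bigr => c _; rewrite scaleNr.
Qed.

Lemma monomial_spanM s t a b :
  monomial_span s a -> monomial_span t b -> monomial_span (s ++ t) (a ⋆ b).
Proof.
move=> [r /allP rs ->] [r' /allP ts ->].
exists [seq (c.1 * d.1, MMul c.2 d.2) | c <- r, d <- r'].
  by apply/allP => _ /allpairsP[[c d] [/= /rs cr /ts dr ->]]; rewrite /= perm_cat.
rewrite big_allpairs_dep /= namul_suml; apply: eq_bigr => c _.
rewrite namul_sumr; apply: eq_bigr => d _.
by rewrite namulZl namulZr scalerA.
Qed.

Lemma monomial_span_perm s t a : perm_eq s t -> monomial_span s a -> monomial_span t a.
Proof.
move=> st [r /allP rs ->]; exists r => //.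
by apply/allP => c /rs rc; apply: perm_trans rc st.
Qed.

Lemma monomial_span_elt U S : (2 < size S)%N -> monomial_span (U ++ S) (assoc_elt gen U S).
Proof.
have gs x : monomial_span [:: x] (gen x) by apply: (monomial_span1 (MVar x)).
move=> Sgt; elim: U => [|x U IHU] /=; last exact: (monomial_spanM (gs x) IHU).
case: S Sgt => [|x [|y [|z S]]] //= _.
have: monomial_span [:: x; y; z] (associator (gen x) (gen y) (gen z)).
  apply: monomial_spanB.
    exact: (monomial_spanM (monomial_spanM (gs x) (gs y)) (gs z)).
  exact: (monomial_spanM (gs x) (monomial_spanM (gs y) (gs z))).
rewrite -[[:: x, y, z & S]]/([:: x; y; z] ++ S); move: [:: x; y; z] (associator _ _ _).
elim: S => [|t S IHS] s a sa; first by rewrite cats0.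
rewrite -cat_rcons; apply: IHS; rewrite -cats1; apply: monomial_spanB.
  exact: monomial_spanM.
by apply: monomial_span_perm (monomial_spanM (gs t) sa); rewrite perm_catC.
Qed.

Lemma monomial_span_multilinear s a :
  perm_eq s (enum 'I_n) -> monomial_span s a -> a \in @multilinear K n.
Proof.
move=> sI [r /allP rs ->]; apply/multilinearP; exists r => //.
by apply/allP => c /rs rc; rewrite multilinear_monomialE (perm_trans rc).
Qed.

Definition bigset := {S : {set 'I_n} | (2 < #|S|)%N}.
HB.instance Definition _ := Finite.on bigset.

Lemma bigset_act_proof (S : bigset) (s : 'S_n) : (2 < #|s @: val S|)%N.
Proof. by rewrite card_imset ?(valP S) //; apply: perm_inj. Qed.
Definition bigset_act (S : bigset) (s : 'S_n) : bigset :=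
  exist _ (s @: val S) (bigset_act_proof S s).
Lemma bigset_act1 S : bigset_act S 1%g = S.
Proof.
apply: val_inj; rewrite /= -[RHS]imset_id; apply: eq_imset => x.
by rewrite perm1.
Qed.
Lemma bigset_actM S s t : bigset_act S (s * t)%g = bigset_act (bigset_act S s) t.
Proof.
apply: val_inj; rewrite /= -imset_comp; apply: eq_imset => x.
by rewrite permM.
Qed.

Definition bigset_repr : representation K [set: 'S_n] :=
  Representation (perm_module K bigset_act1 bigset_actM).

Definition regular_grepr : representation K [set: 'S_n] :=
  Representation (regular_repr K [set: 'S_n]).

Let i0 : 'I_n := Ordinal n_gt0.
Definition perm_word (s : 'S_n) : seq 'I_n := [seq s i | i <- enum 'I_n].
Definition perm_monomial (s : 'S_n) : magma 'I_n :=
  left_normed (head i0 (perm_word s)) (behead (perm_word s)).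
Definition bigset_elt (S : bigset) : Q := assoc_elt gen (enum (~: val S)) (enum (val S)).

Lemma letters_perm_monomial s : letters (perm_monomial s) = perm_word s.
Proof.
rewrite letters_left_normed; have: size (perm_word s) = n by rewrite size_map size_enum_ord.
by case: (perm_word s) => [|x w] //= e; case/eqP: (lt0n_neq0 n_gt0).
Qed.

Lemma perm_perm_word s : perm_eq (perm_word s) (enum 'I_n).
Proof.
apply: uniq_perm; rewrite ?enum_uniq //.
  by rewrite map_inj_uniq ?enum_uniq //; apply: perm_inj.
move=> i; rewrite mem_enum; apply/mapP; exists (s^-1 i)%g; rewrite ?mem_enum //.
by rewrite permKV.
Qed.

Lemma perm_word_inj : injective perm_word.
Proof.
move=> s t /eq_in_map st; apply/permP => i; apply: st.
by rewrite mem_enum.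
Qed.

Lemma perm_wordP (w : seq 'I_n) : perm_eq w (enum 'I_n) -> exists s, w = perm_word s.
Proof.
move=> wI; have sw : size w = n by rewrite (perm_size wI) size_enum_ord.
have inj_w : injective (fun i : 'I_n => nth i0 w i).
  move=> i j /eqP; rewrite nth_uniq ?sw ?ltn_ord ?(perm_uniq wI) ?enum_uniq //.
  by move/eqP/val_inj.
exists (perm inj_w); apply: (@eq_from_nth _ i0) => [|i].
  by rewrite sw size_map size_enum_ord.
rewrite sw => ilt; rewrite (nth_map i0) ?size_enum_ord // permE.
by rewrite nth_enum_ord.
Qed.

Definition normal_form (c : 'S_n -> K) (d : bigset -> K) : Q :=
  \sum_s c s *: ev (perm_monomial s) + \sum_S d S *: bigset_elt S.

Lemma normal_form_monomial u : multilinear_monomial u ->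
  exists c d, ev u = normal_form c d.
Proof.
rewrite multilinear_monomialE => uI.
have [s us] := perm_wordP uI.
have hu : letters u = head i0 (perm_word s) :: behead (perm_word s).
  by rewrite -letters_left_normed -/(perm_monomial s) letters_perm_monomial.
have {hu} := left_normed_span K2 K3 gen hu.
rewrite -letters_left_normed -/(perm_monomial s) letters_perm_monomial -us => hE.
suff [d hd] : exists d, ev u - ev (perm_monomial s) = \sum_S d S *: bigset_elt S.
  exists (fun t => (t == s)%:R), d; rewrite /normal_form -hd (bigD1 s) //= eqxx scale1r.
  rewrite big1 => [|t /negbTE->]; last by rewrite scale0r.
  by rewrite addr0 addrC subrK.
elim: hE => [|k U S a US Sgt _ [d ->]].
  by exists (fun=> 0); rewrite big1 // => S _; rewrite scale0r.
have USu : uniq (U ++ S) by rewrite (perm_uniq US) (perm_uniq uI) enum_uniq.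
have USm x : (x \in U) || (x \in S).
  by rewrite -mem_cat (perm_mem US) (perm_mem uI) mem_enum.
move: USu; rewrite cat_uniq => /and3P[Uu /hasPn US' Su].
have cS : (2 < #|[set x in S]|)%N by rewrite cardsE (card_uniqP Su).
pose T : bigset := exist (fun S0 : {set _} => (2 < #|S0|)%N) [set x in S] cS.
have -> : assoc_elt gen U S = bigset_elt T.
  apply: assoc_elt_perm => //; apply: uniq_perm; rewrite ?enum_uniq // => x;
    rewrite mem_enum !inE //.
  by have := USm x; have := US' x; case: (x \in S) (x \in U) => [] [] // /(_ isT).
exists (fun S => d S + (S == T)%:R * k).
under [RHS]eq_bigr do rewrite scalerDl.
rewrite big_split addrC; congr (_ + _); rewrite (bigD1 T) //= eqxx mul1r big1 ?addr0 // => S'.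
by move=> /negbTE->; rewrite mul0r scale0r.
Qed.

Lemma normal_formP (f : Q) : f \in @multilinear K n -> exists c d, f = normal_form c d.
Proof.
case/multilinearP => r /allP rm ->.
elim: r rm => [|[k u] r IHr] rm.
  exists (fun=> 0), (fun=> 0); rewrite big_nil /normal_form.
  by rewrite !big1 ?addr0 // => *; rewrite scale0r.
have [c' [d' e']] := IHr (fun c cr => rm c (mem_behead (s := _ :: _) cr)).
have [c [d e]] := normal_form_monomial (rm _ (mem_head _ _)).
exists (fun s => k * c s + c' s), (fun S => k * d S + d' S).
rewrite big_cons [X in _ + X]e' [assosym_monomial _ _]e.
exact: (@linear_comb2P K Q).
Qed.

Lemma normal_form_multilinear c d : normal_form c d \in @multilinear K n.
Proof.
have msum (I : finType) (k : I -> K) (F : I -> Q) :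
    (forall i, F i \in @multilinear K n) -> \sum_i k i *: F i \in @multilinear K n.
  by move=> hF; apply: rpred_sum => i _; apply: rpredZ.
apply: rpredD; apply: msum.
  move=> s; apply: (monomial_span_multilinear (perm_perm_word s)).
  by rewrite -letters_perm_monomial; apply: monomial_span1.
move=> S; have Sgt : (2 < size (enum (val S)))%N by rewrite -cardE (valP S).
apply: (monomial_span_multilinear _ (monomial_span_elt _ Sgt)).
by rewrite perm_catC perm_enum_setC.
Qed.

Lemma perm_vars_subst (A : assosymAlgType K) (h : 'I_n -> A) s (f : Q) :
  f \in @multilinear K n ->
  assosym_subst h (perm_vars s f) = assosym_subst (h \o s) f.
Proof.
case/multilinearP => r _ ->; rewrite /perm_vars [X in assosym_subst h X]linear_sum [LHS]linear_sum [RHS]linear_sum; apply: eq_bigr => c _ /=.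
rewrite !linearZ /= -/(perm_vars s _) perm_vars_monomial; congr (_ *: _).
by elim: c.2 => [i|u IHu v IHv] /=; rewrite ?assosym_subst_gen // !assosym_substM IHu IHv.
Qed.

Definition word_coord (s : 'S_n) (f : Q) : K :=
  assosym_subst (word_mx K (perm_word s)) f ord0 ord_max.

(** Here p is the indicator of the complement of T and q - p that of T. On the element of S the
    product of these values is 1 if S = T and 0 otherwise. *)
Definition set_coord (T : {set 'I_n}) (f : Q) : K :=
  (assosym_subst (fun i => tri ((i \notin T)%:R : K) 1 0) f).2.

Fact word_coord_is_scalar s : scalar (word_coord s).
Proof. by move=> k f g; rewrite /word_coord linearP !mxE. Qed.
HB.instance Definition _ s := GRing.isLinear.Build K Q K *%R (word_coord s) (word_coord_is_scalar s).

Fact set_coord_is_scalar T : scalar (set_coord T).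
Proof. by move=> k f g; rewrite /set_coord linearP. Qed.
HB.instance Definition _ T := GRing.isLinear.Build K Q K *%R (set_coord T) (set_coord_is_scalar T).

Lemma linear_normal_form (phi : {scalar Q}) c d :
  phi (normal_form c d) =
  \sum_s c s * phi (ev (perm_monomial s)) + \sum_S d S * phi (bigset_elt S).
Proof.
rewrite /normal_form linearD 2!linear_sum.
by congr (_ + _); apply: eq_bigr => s _; rewrite linearZ.
Qed.

Lemma word_coord_monomial s u : word_coord s (ev u) = (letters u == perm_word s)%:R.
Proof.
rewrite /word_coord -word_mx_coord; congr (fun_of_matrix _ _ _).
by elim: u => [i|u IHu v IHv] /=; rewrite ?assosym_subst_gen // assosym_substM IHu IHv.
Qed.

Lemma word_coord_elt s (S : bigset) : word_coord s (bigset_elt S) = 0.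
Proof.
rewrite /word_coord /bigset_elt morph_assoc_elt; last exact: assosym_substM.
by rewrite assoc_elt_mx mxE.
Qed.

Lemma set_coord_elt (S T : bigset) : set_coord (val T) (bigset_elt S) = (S == T)%:R.
Proof.
rewrite /set_coord /bigset_elt morph_assoc_elt; last exact: assosym_substM.
have Sgt : (2 < size (enum (val S)))%N by rewrite -cardE (valP S).
have -> : assosym_subst (fun i => tri ((i \notin val T)%:R : K) 1 0) \o gen =
    fun i => tri ((i \notin val T)%:R : K) 1 0.
  by apply: boolp.funext => i; rewrite /= assosym_subst_gen.
rewrite assoc_elt_tri //= !big_enum /=; case: eqVneq => [<-|nST].
  rewrite !big1 ?mulr1 // => i; first by move=> iS; rewrite iS subr0.
  by rewrite inE => ->.
have [sST|] := boolP (val S \subset val T).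
  have [i iT iS] : exists2 i, i \in val T & i \notin val S.
    by apply/subsetPn; apply: contraNN nST => sTS; rewrite -val_eqE eqEsubset sST.
  by rewrite (bigD1 i) ?inE //= iT mul0r mul0r.
case/subsetPn => i iS iT; rewrite mulrC (bigD1 i) //= (negbTE iT) subrr.
by rewrite !mul0r.
Qed.

(** Words may have nonzero set coordinates, so this is triangular and not diagonal in the normal
    forms. Since each coordinate is a substitution and moves along with the permutation, bijectivity
    is all that an isomorphism requires. *)
Definition detect (f : P) : 'rV[K]_(rdegree (dadd_grepr regular_grepr bigset_repr)) :=
  row_mx (\row_i word_coord (enum_val i) (val f))
         (\row_j set_coord (val (enum_val j : bigset)) (val f)).

Lemma detect_is_linear : linear detect.
Proof.
move=> k f g; rewrite /detect scale_row_mx add_row_mx.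
by congr row_mx; apply/rowP => i; rewrite !mxE linearP.
Qed.
HB.instance Definition _ := GRing.isLinear.Build K P _ *:%R detect detect_is_linear.

Lemma word_coord_normal_form c d s : word_coord s (normal_form c d) = c s.
Proof.
rewrite linear_normal_form /= [X in _ + X]big1 => [|S _]; last by rewrite word_coord_elt mulr0.
rewrite (bigD1 s) //= word_coord_monomial letters_perm_monomial eqxx mulr1 big1 ?addr0 //.
move=> t /negbTE nts; rewrite word_coord_monomial letters_perm_monomial.
by rewrite (inj_eq perm_word_inj) nts mulr0.
Qed.

Lemma set_coord_normal_form c d (T : bigset) : set_coord (val T) (normal_form c d) =
  \sum_s c s * set_coord (val T) (ev (perm_monomial s)) + d T.
Proof.
rewrite linear_normal_form /=; congr (_ + _).
rewrite (bigD1 T) //= set_coord_elt eqxx mulr1 big1 ?addr0 // => S /negbTE nST.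
by rewrite set_coord_elt nST mulr0.
Qed.

Lemma detect_inj : injective detect.
Proof.
suff ker0 f : detect f = 0 -> f = 0.
  move=> f g fg; apply/eqP; rewrite -subr_eq0; apply/eqP/ker0.
  by rewrite linearB /= fg subrr.
case: f => f fP; rewrite /detect -[0]row_mx0 => /eq_row_mx[/rowP w0 /rowP s0].
apply: val_inj; have [c [d def_f]] := normal_formP fP.
have c0 s : c s = 0.
  rewrite -(word_coord_normal_form c d) -def_f.
  have := w0 (gring_index [set: 'S_n]%G s).
  by rewrite !mxE gring_indexK ?inE.
have d0 S : d S = 0.
  have := set_coord_normal_form c d S; rewrite -def_f.
  have := s0 (enum_rank S); rewrite !mxE enum_rankK => ->.
  by rewrite big1 ?add0r // => s _; rewrite c0 mul0r.
rewrite [LHS]def_f /normal_form !big1 ?addr0 // => i _; rewrite ?c0 ?d0 scale0r //.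
Qed.

Lemma letters_magma_map (s : 'S_n) u : letters (magma_map s u) = map s (letters u).
Proof. by elim: u => //= u -> v ->; rewrite map_cat. Qed.

Lemma word_coord_perm_vars (s t : 'S_n) (f : Q) : f \in @multilinear K n ->
  word_coord t (perm_vars s f) = word_coord (t * s^-1)%g f.
Proof.
case/multilinearP => r _ ->; rewrite /perm_vars [X in word_coord t X]linear_sum.
rewrite [LHS]linear_sum [RHS]linear_sum; apply: eq_bigr => c _ /=.
rewrite !linearZ /= -/(perm_vars s _) perm_vars_monomial !word_coord_monomial.
rewrite letters_magma_map; congr (_ * (nat_of_bool _)%:R).
rewrite -(inj_eq (inj_map (@perm_inj _ s^-1))) (mapK (permK s)) -map_comp.
by congr (_ == _); apply: eq_map => i; rewrite /= permM.
Qed.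

Lemma set_coord_perm_vars (s : 'S_n) (T : {set 'I_n}) (f : Q) : f \in @multilinear K n ->
  set_coord T (perm_vars s f) = set_coord (s^-1%g @: T) f.
Proof.
move=> fP; rewrite /set_coord (perm_vars_subst _ _ fP).
have -> : (fun i => tri ((i \notin T)%:R : K) 1 0) \o s =
    (fun i => tri ((i \notin s^-1%g @: T)%:R : K) 1 0).
  apply: boolp.funext => i /=; congr (tri (nat_of_bool (~~ _))%:R _ _).
  by rewrite -[i in RHS](permK s) mem_imset //; apply: perm_inj.
by [].
Qed.

Lemma mul_regular_repr (v : 'rV[K]_#|[set: 'S_n]|) s i :
  (v *m regular_repr K [set: 'S_n] s) 0 i
  = v 0 (gring_index [set: 'S_n]%G (enum_val i * s^-1)%g).
Proof.
rewrite mxE (bigD1 (gring_index [set: 'S_n]%G (enum_val i * s^-1)%g)) //=.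
rewrite !mxE gring_indexK ?inE // mulgKV gring_valK !eqxx mulr1 big1 ?addr0 //.
move=> j nj; rewrite !mxE eqxx /=; case: eqP => [e|_]; last by rewrite mulr0.
by case/eqP: nj; rewrite e gring_indexK ?inE // mulgK gring_valK.
Qed.

Lemma multilinear_detect : repr_iso (@multilinear_act K n) (dadd_grepr regular_grepr bigset_repr).
Proof.
exists detect; split.
  have surj y : exists f, detect f == y.
    (* Back substitution: the word coordinates fix c, and d corrects the set coordinates by the
       contribution of the words. *)
    pose c s := lsubmx y 0 (gring_index [set: 'S_n]%G s).
    pose d (T : bigset) := rsubmx y 0 (enum_rank T) -
      \sum_s c s * set_coord (val T) (ev (perm_monomial s)).
    exists (MultilinearPart (normal_form_multilinear c d)).
    apply/eqP; rewrite /detect -[RHS]hsubmxK; congr row_mx; apply/rowP => i.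
      by rewrite mxE word_coord_normal_form /c gring_valK.
    by rewrite mxE set_coord_normal_form addrC /d subrK enum_valK.
  exists (fun y => xchoose (surj y)) => [f|y].
    by apply: detect_inj; apply/eqP/(xchooseP (surj _)).
  exact/eqP/(xchooseP (surj y)).
move=> s v _; rewrite /detect mul_row_block !mulmx0 addr0 add0r; congr row_mx.
  apply/rowP => i; rewrite mxE word_coord_perm_vars ?(valP v) //.
  by rewrite mul_regular_repr mxE gring_indexK ?inE.
apply/rowP => j; rewrite mxE set_coord_perm_vars ?(valP v) //.
have -> : j = enum_rank (bigset_act (bigset_act (enum_val j) s^-1) s).
  by rewrite -bigset_actM mulVg bigset_act1 enum_valK.
by rewrite mul_perm_module mxE !enum_rankK -bigset_actM mulVg bigset_act1.
Qed.

End Multi.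

(** * Representations determined by ranks of group algebra elements *)

Section GroupAlgebraOperators.
Variables (F : fieldType) (gT : finGroupType) (G : {group gT}).
Local Notation reprG := (representation F G).
Implicit Types (a b : gT -> F) (r : reprG).

Definition gring_sum a n (rG : mx_representation F G n) : 'M[F]_n :=
  \sum_(g in G) a g *: rG g.

(** Matrices act on row vectors, so [a] is applied before [b]. *)
Definition op_rank a b n (rG : mx_representation F G n) : nat :=
  \rank (gring_sum a rG *m gring_sum b rG).

Lemma gring_sum_hom a n1 n2 (r1 : mx_representation F G n1)
    (r2 : mx_representation F G n2) B :
  (forall x, x \in G -> r1 x *m B = B *m r2 x) ->
  gring_sum a r1 *m B = B *m gring_sum a r2.
Proof.
move=> homB; rewrite mulmx_suml mulmx_sumr; apply: eq_bigr => g gG.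
by rewrite -scalemxAl -scalemxAr homB.
Qed.

Lemma op_rank_rsim a b n1 n2 (r1 : mx_representation F G n1)
    (r2 : mx_representation F G n2) :
  mx_rsim r1 r2 -> op_rank a b r1 = op_rank a b r2.
Proof.
case=> B e; case: n2 / e r2 B => r2 B freeB homB; rewrite /op_rank.
rewrite -(mxrankMfree _ freeB) -mulmxA (gring_sum_hom b homB) mulmxA (gring_sum_hom a homB).
by rewrite -mulmxA eqmxMfull // row_full_unit -row_free_unit.
Qed.

Lemma gring_sum_dadd a r1 r2 :
  gring_sum a (dadd_grepr r1 r2) = block_mx (gring_sum a r1) 0 0 (gring_sum a r2).
Proof.
rewrite /gring_sum; apply: (big_rec3 (fun A B C => A = block_mx B 0 0 C)).
  by rewrite block_mx0.
move=> g _ B C gG ->; rewrite scale_block_mx !scaler0 add_block_mx !addr0 //.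
Qed.

Lemma op_rank_dadd a b r1 r2 :
  op_rank a b (dadd_grepr r1 r2) = (op_rank a b r1 + op_rank a b r2)%N.
Proof.
by rewrite /op_rank !gring_sum_dadd mulmx_block !(mul0mx, mulmx0) !addr0 add0r rank_diag_block_mx.
Qed.

Lemma op_rank_big a b (I : Type) (s : seq I) (P : pred I) (r : I -> reprG) :
  op_rank a b (\big[dadd_grepr/grepr0]_(i <- s | P i) r i)
  = (\sum_(i <- s | P i) op_rank a b (r i))%N.
Proof.
apply: (big_morph (fun r : reprG => op_rank a b r)); first exact: op_rank_dadd.
by apply/eqP; rewrite -leqn0 rank_leq_row.
Qed.

Lemma op_rank_muln a b r k : op_rank a b (muln_grepr r k) = (k * op_rank a b r)%N.
Proof. by rewrite op_rank_big sum_nat_const card_ord. Qed.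

End GroupAlgebraOperators.

Section Classification.
Variables (F : closedFieldType) (gT : finGroupType) (G : {group gT}).
Hypothesis F'G : ([pchar F]^'.-group G)%g.
Local Notation reprG := (representation F G).
Variables (I : finType) (S : I -> reprG) (a b : I -> gT -> F).
Hypotheses (irrS : forall i, mx_irreducible (S i))
  (rankS : forall i j, op_rank (a j) (b j) (S i) = (i == j))
  (cardI : (#|classes G| <= #|I|)%N).

Let splitG : group_splitting_field F G := @group_closure_closed_field F gT G.
Let iG : irrType F G := DecSocleType (regular_repr F G).
Let irrI i : iG := irr_comp iG (S i).

Let irrI_inj : injective irrI.
Proof.
move=> i j eij; apply/eqP; rewrite -[_ == _]lt0b -rankS.
rewrite (@op_rank_rsim _ _ _ _ _ _ _ _ (S j)) ?rankS ?eqxx //.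
apply: mx_rsim_trans (rsim_irr_comp_pchar iG F'G (irrS i)) _.
by rewrite -/(irrI i) eij; apply/mx_rsim_sym/rsim_irr_comp_pchar.
Qed.

Let irrI_onto W : exists i, W == irrI i.
Proof.
have: W \in codom irrI; last by case/codomP => i ->; exists i.
apply: inj_card_onto; first exact: irrI_inj.
by rewrite (card_irr_pchar iG F'G splitG).
Qed.

Let idx W : I := xchoose (irrI_onto W).

Let irr_idx W : mx_rsim (irr_repr W) (S (idx W)).
Proof.
have := rsim_irr_comp_pchar iG F'G (irrS (idx W)).
by rewrite -/(irrI _) -(eqP (xchooseP (irrI_onto W))) => /mx_rsim_sym.
Qed.

Let idxK i : idx (irrI i) = i.
Proof. by apply/esym/irrI_inj/eqP/(xchooseP (irrI_onto (irrI i))). Qed.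

Section Decomposition.
Variables (n : nat) (rG : mx_representation F G n) (sG : socleType rG).

Let type (W : sG) : I := idx (irr_comp iG (socle_repr W)).

Let type_rsim W : mx_rsim (socle_repr W) (S (type W)).
Proof.
apply: mx_rsim_trans (irr_idx _).
exact/rsim_irr_comp_pchar/socle_irr.
Qed.

Let type_inj : injective type.
Proof.
move=> W1 W2 e; apply/eqP/socle_rsimP.
by apply: mx_rsim_trans (type_rsim W1) _; rewrite e; apply: mx_rsim_sym.
Qed.

(** A socle lists only the components that occur; the other types receive multiplicity 0. *)
Definition type_mult i : nat := oapp (@socle_mult _ _ _ _ _ sG) 0%N [pick W | type W == i].

Lemma rsim_type_mult : mx_rsim rG (\big[dadd_grepr/grepr0]_i muln_grepr (S i) (type_mult i)).
Proof.
pose soc i := [pick W | type W == i]; pose U i : 'M_n := oapp val 0 (soc i).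
have sum_soc (R : Type) (idx0 : R) (op : Monoid.com_law idx0) (f : sG -> R) :
    \big[op/idx0]_W f W = \big[op/idx0]_i oapp f idx0 (soc i).
  rewrite (partition_big type xpredT) //; apply: eq_bigr => i _; rewrite /soc.
  case: pickP => [W /eqP tW|noW] /=; last by rewrite big_pred0.
  by rewrite (big_pred1 W) // => W' /=; rewrite -tW (inj_eq type_inj).
have modU i : mxmodule rG (U i).
  rewrite /U; case: (soc i) => [W|] /=; last exact: mxmodule0.
  exact: component_mx_module.
have soc1 : Socle sG = 1%:M := reducible_Socle1 sG (mx_Maschke_pchar rG F'G).
have sumU : (\sum_i U i)%MS = (\sum_(W : sG) W)%MS by rewrite sum_soc.
have dxU : mxdirect (\sum_i U i)%MS.
  rewrite mxdirectE /= sumU; have := mxdirectP (Socle_direct sG) => /= ->.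
  rewrite (sum_soc _ _ addn); apply/eqP/eq_bigr => i _.
  by rewrite /U; case: (soc i) => [W|] //=; rewrite mxrank0.
apply: mx_rsim_trans (mx_rsim_sym (rsim_submod1 (mxmodule1 rG) _)) _ => //.
have h := @mx_rsim_dsum _ _ _ _ rG I xpredT U (fun i => muln_grepr (S i) (type_mult i))
  1%:M modU (mxmodule1 rG).
apply: h => // [|i]; first by rewrite sumU -/(Socle sG) soc1.
move: (modU i); rewrite /U /type_mult -/(soc i).
have: forall W, soc i = Some W -> type W = i.
  by rewrite /soc => W; case: pickP => // W' /eqP <- [->].
case: (soc i) => [W|] /= tW modW; last first.
  by rewrite /muln_grepr big_ord0; exists 0 => [||x _]; rewrite /row_free ?mxrank0 ?mulmx0 ?mul0mx.
rewrite -(tW W erefl) (bool_irrelevance modW (component_mx_module rG (socle_base W))).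
exact/mx_rsim_socle/type_rsim.
Qed.

Lemma op_rank_type_mult i : op_rank (a i) (b i) rG = type_mult i.
Proof.
rewrite (op_rank_rsim _ _ rsim_type_mult) op_rank_big (bigD1 i) //= big1 => [|j nji].
  by rewrite op_rank_muln rankS eqxx muln1 addn0.
by rewrite op_rank_muln rankS (negbTE nji) muln0.
Qed.

End Decomposition.

Lemma rsim_op_rank n (rG : mx_representation F G n) :
  mx_rsim rG (\big[dadd_grepr/grepr0]_i muln_grepr (S i) (op_rank (a i) (b i) rG)).
Proof.
rewrite (eq_bigr (fun i => muln_grepr (S i) (type_mult (DecSocleType rG) i))).
  exact: rsim_type_mult.
by move=> i _; rewrite (op_rank_type_mult (DecSocleType rG)).
Qed.

Lemma eq_op_rank_rsim n1 n2 (r1 : mx_representation F G n1) (r2 : mx_representation F G n2) :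
  (forall i, op_rank (a i) (b i) r1 = op_rank (a i) (b i) r2) -> mx_rsim r1 r2.
Proof.
move=> e12; apply: mx_rsim_trans (rsim_op_rank r1) _.
apply: mx_rsim_sym; apply: mx_rsim_trans (rsim_op_rank r2) _.
by rewrite (eq_bigr _ (fun i _ => congr1 (muln_grepr (S i)) (e12 i))); apply: mx_rsim_refl.
Qed.

Lemma op_rank_regular i : op_rank (a i) (b i) (regular_repr F G) = rdegree (S i).
Proof.
rewrite (op_rank_type_mult iG) /type_mult.
(* Every irreducible module occurs in the regular one, which excludes the default 0. *)
case: pickP => [W /eqP/= <-|/(_ (irrI i))] /=; last first.
  by rewrite (irr_reprK_pchar F'G) idxK eqxx.
rewrite (irr_mx_mult_pchar F'G splitG) -(mxrank_rsim (irr_idx _)).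
by rewrite -/(irr_repr W) (irr_reprK_pchar F'G).
Qed.

End Classification.

(** * Tableaux *)

Section IntPart.
Local Open Scope nat_scope.
Variable n : nat.
Implicit Types (lam mu : intpart n) (r c : nat).

Lemma size_parts lam : size [seq val i | i <- parts lam] = n.
Proof. by rewrite size_map size_tuple. Qed.

Lemma part_sorted lam : sorted geq [seq val i | i <- parts lam].
Proof. by case: lam => p /= /andP[]. Qed.

Lemma part_leq lam r : part lam r <= n.
Proof.
rewrite /part; have [rn|nr] := ltnP r (size (parts lam)).
  by rewrite (nth_map ord0) // -ltnS ltn_ord.
by rewrite nth_default // size_map.
Qed.

Lemma part_default lam r : n <= r -> part lam r = 0.
Proof. by move=> nr; rewrite /part nth_default // size_parts. Qed.

Lemma part_mono lam r s : r <= s -> part lam s <= part lam r.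
Proof.
move=> rs; have [sn|/(part_default lam)->//] := ltnP s n.
have geq_trans : transitive geq by move=> a b c /= ba cb; apply: leq_trans cb ba.
have := sorted_leq_nth geq_trans (fun a => leqnn a) 0 (part_sorted lam).
by move/(_ r s); rewrite !inE size_parts => h; apply: h => //; apply: leq_ltn_trans sn.
Qed.

Lemma part_sum lam : \sum_(r < n) part lam r = n.
Proof.
have /andP[_ /eqP] := valP lam.
rewrite sumnE (big_nth 0) size_parts big_mkord => e; rewrite -[RHS]e.
by apply: eq_bigr.
Qed.

Lemma part_inj lam mu : (forall r, r < n -> part lam r = part mu r) -> lam = mu.
Proof.
move=> e; apply/val_inj/val_inj/(inj_map val_inj)/(@eq_from_nth _ 0).
  by rewrite !size_parts.
by move=> r; rewrite size_parts => /e.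
Qed.

Lemma part_sum_inj lam mu :
  (forall r, r <= n -> \sum_(i < r) part lam i = \sum_(i < r) part mu i) -> lam = mu.
Proof.
move=> e; apply: part_inj => r rn; have := e r.+1 rn.
by rewrite !big_ord_recr /= e ?(ltnW rn) // => /addnI.
Qed.

Definition cells lam : {set 'I_n * 'I_n} := [set p : 'I_n * 'I_n | p.2 < part lam p.1].

Lemma card_ltn_ord m : m <= n -> #|[set i : 'I_n | i < m]| = m.
Proof.
move=> mn; have winj : injective (widen_ord mn) by move=> i j [] /val_inj.
rewrite -[RHS](card_ord m) -(card_imset _ winj).
apply: eq_card => i; rewrite inE; apply/idP/imsetP => [im|[j _ ->]]; last exact: (valP j).
by exists (Ordinal im) => //; apply: val_inj.
Qed.

Lemma card_cells lam : #|cells lam| = n.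
Proof.
rewrite -[RHS](part_sum lam) -sum1_card.
rewrite (eq_bigl (fun p : 'I_n * 'I_n => xpredT p.1 && (p.2 < part lam p.1))); last first.
  by move=> p; rewrite inE.
rewrite -(pair_big_dep xpredT (fun r c : 'I_n => c < part lam r) (fun _ _ => 1)) /=.
apply: eq_bigr => r _; rewrite sum1_card -[RHS](card_ltn_ord (part_leq lam r)).
by apply: eq_card => c; rewrite !inE.
Qed.
Local Notation row t x := (t x).1.
Local Notation col t x := (t x).2.

Variables (lam : intpart n) (t : {ffun 'I_n -> 'I_n * 'I_n}).
Hypothesis tP : is_tableau lam t.

Lemma tableau_inj : injective t.
Proof. by case/andP: tP => /injectiveP. Qed.

Lemma tableau_col x : col t x < part lam (row t x).
Proof. by case/andP: tP => _ /forallP. Qed.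

Lemma tableau_onto (r c : 'I_n) : c < part lam r -> exists x, t x = (r, c).
Proof.
move=> rc; have: (r, c) \in [set t x | x in [set: 'I_n]].
  suff -> : [set t x | x in [set: 'I_n]] = cells lam by rewrite inE.
  apply/eqP; rewrite eqEcard card_imset; last exact: tableau_inj.
  rewrite card_cells cardsT card_ord leqnn andbT.
  by apply/subsetP => _ /imsetP[x _ ->]; rewrite inE tableau_col.
by case/imsetP => x _ ->; exists x.
Qed.

Lemma card_tableau_row (r : 'I_n) : #|[set x | row t x == r]| = part lam r.
Proof.
rewrite -(card_imset _ tableau_inj) -[RHS](card_ltn_ord (part_leq lam r)).
have pair_inj : injective (fun c : 'I_n => (r, c)) by move=> c d [].
rewrite -(card_imset _ pair_inj); apply: eq_card => -[r' c].
apply/imsetP/imsetP => [[x]|[d]]; rewrite inE.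
  by move=> /eqP xr ->; exists (col t x); rewrite -xr ?inE ?tableau_col //; case: (t x).
by move=> /tableau_onto[x tx] [-> ->]; exists x; rewrite ?tx // inE tx.
Qed.

Definition has_content mu (f : 'I_n -> 'I_n) := forall r : 'I_n, #|[set x | f x == r]| = part mu r.

Lemma card_content mu f m : has_content mu f -> m <= n ->
  #|[set x | f x < m]| = \sum_(i < m) part mu i.
Proof.
move=> fmu mn; rewrite (big_ord_widen n (part mu) mn) -sum1_card.
rewrite (partition_big f (fun i : 'I_n => i < m)) /=; last by move=> x; rewrite inE.
apply: eq_bigr => r rm; rewrite -fmu -sum1_card; apply: eq_bigl => x.
by rewrite !inE; case: eqP => [->|]; rewrite ?rm ?andbF.
Qed.

Section ColumnInjective.
Variables (mu : intpart n) (f : 'I_n -> 'I_n).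
Hypotheses (fmu : has_content mu f)
  (f_inj : forall x y, col t x = col t y -> f x = f y -> x = y).

Let A (c : 'I_n) r := [set x | (col t x == c) && (f x < r)].
Let B (c : 'I_n) r := [set x | (col t x == c) && (row t x < r)].

(** Either column c lies within the first r rows and B is the whole column, or it reaches row r;
    then it has a cell in each of the first r rows, while f takes at most r values below r, each
    once. *)
Lemma column_card_leq (c : 'I_n) r : r <= n -> #|A c r| <= #|B c r|.
Proof.
move=> rn; have [/forallP h|] := boolP [forall x, (col t x == c) ==> (row t x < r)].
  apply/subset_leq_card/subsetP => x; rewrite !inE => /andP[xc _].
  by rewrite xc (implyP (h x)).
rewrite negb_forall => /existsP[y]; rewrite negb_imply -leqNgt => /andP[/eqP yc ry].
have fA : {in A c r &, injective f}.
  by move=> x x'; rewrite !inE => /andP[/eqP xc _] /andP[/eqP x'c _]; apply: f_inj; rewrite xc.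
rewrite -(card_in_imset fA); apply: leq_trans (leq_imset_card (fun x => row t x) _).
apply: (@leq_trans #|[set i : 'I_n | i < r]|); apply/subset_leq_card/subsetP => i.
  by case/imsetP => x; rewrite !inE => /andP[_ xr] ->.
rewrite inE => ir; apply/imsetP.
have [|x tx] := @tableau_onto i c.
  by rewrite -yc (leq_trans (tableau_col y)) // part_mono // (leq_trans (ltnW ir)).
by exists x; rewrite ?inE tx ?eqxx.
Qed.

Let sum_columns (g : 'I_n -> 'I_n) r :
  \sum_(c < n) #|[set x | (col t x == c) && (g x < r)]| = #|[set x | g x < r]|.
Proof.
rewrite -[RHS]sum1_card [RHS](partition_big (fun x => col t x) xpredT) //.
by apply: eq_bigr => c _; rewrite -sum1_card; apply: eq_bigl => x; rewrite !inE andbC.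
Qed.

Lemma content_dominated r : r <= n ->
  \sum_(i < r) part mu i <= \sum_(i < r) part lam i.
Proof.
move=> rn; rewrite -(card_content fmu rn).
rewrite -(@card_content lam (fun x => row t x)) //; last exact: card_tableau_row.
by rewrite -!sum_columns; apply: leq_sum => c _; apply: column_card_leq.
Qed.

Hypothesis mu_lam : mu = lam.

Lemma column_card_eq (c : 'I_n) r : r <= n -> #|A c r| = #|B c r|.
Proof.
move=> rn; apply/eqP; have := leqif_sum (fun (c : 'I_n) (_ : xpredT c) => leqif_eq (column_card_leq c rn)).
case=> _; rewrite !sum_columns (card_content fmu rn) mu_lam.
rewrite (@card_content lam (fun x => row t x)) ?eqxx //; last exact: card_tableau_row.
by move/esym/forall_inP; apply.
Qed.

(** If [f x] were at least the length of the column, then B for r = [f x] would be the whole column,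
    and equality of cardinals would put x into A, that is [f x] below itself. *)
Lemma content_in_column x : col t x < part lam (f x).
Proof.
rewrite ltnNge; apply/negP => fx; set c := col t x.
have colB y : col t y == c -> row t y < f x.
  move=> /eqP yc; rewrite ltnNge; apply/negP => fy.
  have := tableau_col y; rewrite yc ltnNge => /negP[].
  exact: leq_trans (part_mono lam fy) fx.
have AB : A c (f x) = B c (f x).
  apply/eqP; rewrite eqEcard column_card_eq ?leqnn ?andbT; last exact/ltnW.
  by apply/subsetP => y; rewrite !inE => /andP[yc _]; rewrite yc colB.
have: x \in B c (f x) by rewrite inE eqxx colB.
by rewrite -AB inE ltnn andbF.
Qed.

Lemma content_column_perm : exists2 s : 'S_n, s \in col_stab t & forall x, f x = row t (s x).
Proof.
have ex x : exists y, t y == (f x, col t x).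
  by have [y ty] := tableau_onto (content_in_column x); exists y; rewrite ty.
pose s x := xchoose (ex x).
have sE x : t (s x) = (f x, col t x) by apply/eqP/(xchooseP (ex x)).
have s_inj : injective s.
  by move=> x y e; have := sE x; rewrite e sE => -[] /esym fxy /esym cxy; apply: f_inj.
exists (perm s_inj) => [|x]; last by rewrite permE sE.
by rewrite inE; apply/forallP => x; rewrite permE sE.
Qed.

End ColumnInjective.

End IntPart.

Lemma exists_tableau n (lam : intpart n) : exists t, is_tableau lam t.
Proof.
exists [ffun i => enum_val (cast_ord (esym (card_cells lam)) i)].
apply/andP; split; first by apply/injectiveP => i j; rewrite !ffunE => /enum_val_inj/cast_ord_inj.
apply/forallP => i; rewrite ffunE.
by have := enum_valP (cast_ord (esym (card_cells lam)) i); rewrite inE.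
Qed.

(** * Specht modules *)

Section SubmodRank.
Variables (F : fieldType) (gT : finGroupType) (G : {group gT}) (n : nat).
Variables (rG : mx_representation F G n) (U : 'M[F]_n) (Umod : mxmodule rG U).

Lemma val_submod_gring_sum a m (W : 'M_(m, \rank U)) :
  val_submod (W *m gring_sum a (submod_repr Umod)) = val_submod W *m gring_sum a rG.
Proof.
rewrite /gring_sum !mulmx_sumr linear_sum; apply: eq_bigr => g gG.
by rewrite -!scalemxAr linearZ /= -val_submodJ.
Qed.

Lemma op_rank_submod a b :
  op_rank a b (submod_repr Umod) = \rank (U *m gring_sum a rG *m gring_sum b rG).
Proof.
rewrite /op_rank -[X in \rank X]mul1mx -(mxrankMfree _ (row_base_free U)).
rewrite -[_ *m row_base U]/(val_submod _) mulmxA !val_submod_gring_sum.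
by rewrite (eqmxMr _ (eqmxMr _ (val_submod1 U))).
Qed.

Lemma mxmodule_gring_sum a : (U *m gring_sum a rG <= U)%MS.
Proof.
rewrite mulmx_sumr; apply: summx_sub => g gG.
by rewrite -scalemxAr scalemx_sub // (mxmoduleP Umod).
Qed.

End SubmodRank.

Section Twisted.
Variables (K : fieldType) (n : nat) (g : 'I_n -> 'I_n) (e : 'S_n -> K).
Hypothesis eM : forall s t, e (s * t)%g = e s * e t.
Variables (m : nat) (rG : mx_representation K [set: 'S_n] m).

(** Row symmetrizers and column antisymmetrizers are treated together: g is the row or the column of
    a tableau, e the trivial or the sign character. *)
Definition fiber_stab : {set 'S_n} := [set s : 'S_n | [forall i, g (s i) == g i]].

Lemma fiber_stabP (s : 'S_n) : reflect (forall i, g (s i) = g i) (s \in fiber_stab).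
Proof. by rewrite inE; apply: (iffP forallP) => h i; apply/eqP. Qed.

Lemma fiber_stab_group_set : group_set fiber_stab.
Proof.
apply/group_setP; split=> [|s t /fiber_stabP hs /fiber_stabP ht]; apply/fiber_stabP => i.
  by rewrite perm1.
by rewrite permM ht hs.
Qed.
Canonical fiber_stab_group := Group fiber_stab_group_set.

Definition twist (s : 'S_n) : K := if s \in fiber_stab then e s else 0.

Lemma gring_sum_twist : gring_sum twist rG = \sum_(s in fiber_stab) e s *: rG s.
Proof.
rewrite /gring_sum [RHS]big_mkcond; apply: eq_big => s; first by rewrite inE.
by rewrite /twist => _; case: ifP => // _; rewrite scale0r.
Qed.

Lemma twist_mull s : s \in fiber_stab ->
  e s *: (rG s *m gring_sum twist rG) = gring_sum twist rG.
Proof.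
move=> sS; rewrite gring_sum_twist mulmx_sumr scaler_sumr.
rewrite [RHS](reindex_inj (mulgI s)) /=; apply: eq_big => t; first by rewrite groupMl.
by move=> _; rewrite -scalemxAr scalerA eM repr_mxM ?inE.
Qed.

Lemma twist_mulr s : s \in fiber_stab ->
  e s *: (gring_sum twist rG *m rG s) = gring_sum twist rG.
Proof.
move=> sS; rewrite gring_sum_twist mulmx_suml scaler_sumr.
rewrite [RHS](reindex_inj (mulIg s)) /=; apply: eq_big => t; first by rewrite groupMr.
by move=> _; rewrite -scalemxAl scalerA eM repr_mxM ?inE // mulrC.
Qed.

Lemma twist_id : (forall s, s \in fiber_stab -> e s * e s = 1) ->
  gring_sum twist rG *m gring_sum twist rG = #|fiber_stab|%:R *: gring_sum twist rG.
Proof.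
move=> ee; rewrite {1}gring_sum_twist mulmx_suml.
rewrite (eq_bigr (fun=> gring_sum twist rG)) => [|s sS].
  by rewrite sumr_const scaler_nat.
by rewrite -scalemxAl twist_mull.
Qed.

End Twisted.

Section Specht.
Variables (K : fieldType) (n : nat).
Hypothesis charK0 : [pchar K] =i pred0.
Local Notation T := {ffun 'I_n -> 'I_n}.
Local Notation row t := (fun x => (t x).1).
Local Notation col t := (fun x => (t x).2).
Implicit Types (lam mu : intpart n) (t : {ffun 'I_n -> 'I_n * 'I_n}) (f : T).

Definition sgn (s : 'S_n) : K := (-1) ^+ s.
Lemma sgnM (s u : 'S_n) : sgn (s * u)%g = sgn s * sgn u.
Proof. by rewrite /sgn odd_permM signr_addb. Qed.
Lemma sgnK (s : 'S_n) : sgn s * sgn s = 1.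
Proof. by rewrite /sgn -signr_addb addbb. Qed.

Definition col_coef t := twist (col t) sgn.
Definition row_coef t := twist (row t) (fun=> 1 : K).

Lemma natK_neq0 m : (0 < m)%N -> m%:R != 0 :> K.
Proof. by have [h _] := pcharf0P K; rewrite (h charK0) -lt0n. Qed.

Lemma eqN_eq0 (V : lmodType K) (v : V) : v = - v -> v = 0.
Proof.
move=> vN; apply/eqP; have: 2%:R *: v == 0 by rewrite scaler_nat mulr2n {2}vN subrr.
by rewrite scaler_eq0 (negbTE (@natK_neq0 2 isT)).
Qed.

Lemma tabloid_col_sum t :
  polytabloid K t = tabloid_vec K (tabloid t) *m gring_sum (col_coef t) (tabloid_repr K n).
Proof.
rewrite gring_sum_twist mulmx_sumr; apply: eq_bigr => s _.
by rewrite -scalemxAr tabloid_vecM tabloid_relabel.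
Qed.

(** The transposition of x and y fixes the tabloid and negates the antisymmetrizer. *)
Lemma tabloid_col_sum_eq0 t f x y : x != y -> (t x).2 = (t y).2 -> f x = f y ->
  tabloid_vec K f *m gring_sum (col_coef t) (tabloid_repr K n) = 0.
Proof.
move=> nxy cxy fxy; set k := gring_sum _ _.
have sS : tperm x y \in fiber_stab (col t) by apply/fiber_stabP => i; case: tpermP => // ->.
have := twist_mull sgnM (tabloid_repr K n) sS; rewrite -/k {1}/sgn odd_tperm nxy expr1 => e.
have fs : tabloid_vec K f *m tabloid_repr K n (tperm x y) = tabloid_vec K f.
  rewrite tabloid_vecM; congr tabloid_vec; apply/ffunP => i.
  by rewrite ffunE tpermV; case: tpermP => // ->.
by apply: eqN_eq0; rewrite -{1}e -scalemxAr mulmxA fs scaleN1r.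
Qed.

Lemma tabloid_tableau_content lam t : is_tableau lam t -> has_content lam (tabloid t).
Proof.
move=> tP r; rewrite -(card_tableau_row tP); apply: eq_card => x.
by rewrite !inE ffunE.
Qed.

Lemma content_relabel mu f s : has_content mu f -> has_content mu (relabel s f).
Proof.
move=> fmu r; rewrite -fmu -[RHS](card_imset _ (@perm_inj _ s)); apply: eq_card => x.
rewrite !inE ffunE; apply/idP/imsetP => [h|[y]]; last by rewrite inE => yr ->; rewrite permK.
by exists (s^-1 x)%g; rewrite ?inE ?permKV.
Qed.

Lemma tabloid_content_col_sum mu lam t f : is_tableau lam t -> has_content mu f ->
  tabloid_vec K f *m gring_sum (col_coef t) (tabloid_repr K n) != 0 ->
  forall x y, (t x).2 = (t y).2 -> f x = f y -> x = y.
Proof.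
move=> tP fmu nz x y cxy fxy; apply/eqP; apply: contraNT nz => nxy.
by rewrite (tabloid_col_sum_eq0 nxy cxy fxy).
Qed.

(** A tabloid that is not annihilated is injective on the columns of [t], hence is a column
    permutation of the tabloid of [t], which changes the result by a sign only. *)
Lemma tabloid_content_sub lam t f : is_tableau lam t -> has_content lam f ->
  (tabloid_vec K f *m gring_sum (col_coef t) (tabloid_repr K n) <= polytabloid K t)%MS.
Proof.
move=> tP flam; set k := gring_sum _ _.
have [->|nz] := eqVneq (tabloid_vec K f *m k) 0; first exact: sub0mx.
have [s sC fs] := content_column_perm tP flam (tabloid_content_col_sum tP flam nz) erefl.
have sS : s^-1%g \in fiber_stab (col t) by rewrite groupV.
have -> : f = relabel s^-1 (tabloid t).
  by apply/ffunP => x; rewrite !ffunE invgK fs.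
rewrite -tabloid_vecM -mulmxA tabloid_col_sum.
have e := twist_mull sgnM (tabloid_repr K n) sS; rewrite -/k -/(col_coef t) in e.
by rewrite -[X in (_ <= _ *m X)%MS]e -scalemxAr eqmx_scale ?signr_eq0.
Qed.

Section SpechtModule.
Variables (lam : intpart n) (t : {ffun 'I_n -> 'I_n * 'I_n}).
Hypothesis tP : is_tableau lam t.
Local Notation S := (specht_mx K lam).
Local Notation kap := (gring_sum (col_coef t) (tabloid_repr K n)).
Local Notation rho := (gring_sum (row_coef t) (tabloid_repr K n)).

Lemma polytabloid_expand m (t' : {ffun 'I_n -> 'I_n * 'I_n}) (M : 'M_(_, m)) :
  polytabloid K t' *m M =
  \sum_(s in col_stab t') sgn s *: (tabloid_vec K (relabel s (tabloid t')) *m M).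
Proof.
rewrite mulmx_suml; apply: eq_bigr => s _.
by rewrite -scalemxAl tabloid_relabel.
Qed.

Lemma specht_col_sub : (S *m kap <= polytabloid K t)%MS.
Proof.
rewrite sumsmxMr; apply/sumsmx_subP => t' t'P.
rewrite (eqmxMr _ (genmxE _)) polytabloid_expand summx_sub // => s _.
apply/scalemx_sub/(tabloid_content_sub tP)/content_relabel.
exact: tabloid_tableau_content.
Qed.

Lemma polytabloid_specht : (polytabloid K t <= S)%MS.
Proof. by rewrite (sumsmx_sup t) ?genmxE. Qed.

Lemma polytabloid_col : polytabloid K t *m kap = #|fiber_stab (col t)|%:R *: polytabloid K t.
Proof.
by rewrite tabloid_col_sum -mulmxA (twist_id sgnM) ?scalemxAr // => s _; apply: sgnK.
Qed.

Lemma row_col_stab (r s : 'S_n) : r \in fiber_stab (row t) -> s \in fiber_stab (col t) ->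
  relabel r (relabel s (tabloid t)) = tabloid t -> s = 1%g.
Proof.
move=> /fiber_stabP rR /fiber_stabP sC /ffunP e; apply/permP => i; rewrite perm1.
apply: (tableau_inj tP); have := e (r (s i)); rewrite !ffunE !permK rR.
by have := sC i; case: (t (s i)) (t i) => [a b] [c d] /= -> ->.
Qed.

(** The coefficient of the tabloid of [t] counts the row permutations, as no column permutation
    other than 1 can be undone by a row permutation. *)
Lemma polytabloid_row_neq0 : polytabloid K t *m rho != 0.
Proof.
suff e : (polytabloid K t *m rho) 0 (enum_rank (tabloid t)) = #|fiber_stab (row t)|%:R.
  apply/eqP => z; move: e; rewrite z mxE => /esym/eqP; apply/negP/natK_neq0.
  by rewrite cardG_gt0.
rewrite polytabloid_expand summxE (bigD1 1%g) /=; last by rewrite inE; apply/forallP => i; rewrite perm1.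
rewrite big1 ?addr0 => [|s /andP[sC ns]].
  rewrite relabel1 /sgn odd_perm1 expr0 scale1r gring_sum_twist mulmx_sumr summxE -sumr_const.
  apply: eq_bigr => r /fiber_stabP rR; rewrite scale1r tabloid_vecM.
  have -> : relabel r (tabloid t) = tabloid t.
    by apply/ffunP => i; rewrite !ffunE -[in RHS](permKV r i) rR.
  by rewrite mxE !eqxx.
rewrite mxE gring_sum_twist mulmx_sumr summxE big1 ?mulr0 // => r rR.
rewrite scale1r tabloid_vecM mxE eqxx /= (inj_eq enum_rank_inj) eq_sym.
by case: eqP => // e; rewrite (row_col_stab rR sC e) eqxx in ns.
Qed.

Lemma specht_op_rank : op_rank (col_coef t) (row_coef t) (specht K lam) = 1%N.
Proof.
rewrite op_rank_submod; apply/eqP; rewrite eqn_leq; apply/andP; split.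
  apply: leq_trans (mxrankS (submxMr _ specht_col_sub)) _.
  by apply: leq_trans (mxrankM_maxl _ _) (rank_leq_row _).
have nz := polytabloid_row_neq0; rewrite lt0n mxrank_eq0.
apply: contraNneq nz => z.
have : (polytabloid K t *m kap *m rho <= S *m kap *m rho)%MS.
  by rewrite !submxMr // polytabloid_specht.
rewrite z submx0 polytabloid_col -scalemxAl scaler_eq0 => /orP[/eqP c0|//].
have : #|fiber_stab (col t)|%:R != 0 :> K by rewrite natK_neq0 ?cardG_gt0.
by rewrite c0 eqxx.
Qed.

Lemma tableau_relabel t' : is_tableau lam t' -> exists s, t' = relabel s t.
Proof.
move=> t'P; have ex j : exists i, t i == t' j.
  have [i ti] := tableau_onto tP (tableau_col t'P j); exists i.
  by rewrite ti; case: (t' j).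
have inj_s : injective (fun j => xchoose (ex j)).
  move=> i j e; apply: (tableau_inj t'P).
  by rewrite -(eqP (xchooseP (ex i))) e (eqP (xchooseP (ex j))).
exists (perm inj_s)^-1%g; apply/ffunP => j; rewrite ffunE invgK permE.
by rewrite (eqP (xchooseP (ex j))).
Qed.

Lemma specht_min m (U : 'M_(m, _)) : mxmodule (tabloid_repr K n) U ->
  (polytabloid K t <= U)%MS -> (S <= U)%MS.
Proof.
move=> Umod tU; apply/sumsmx_subP => t' /tableau_relabel[s ->].
rewrite genmxE -polytabloidM; apply: submx_trans (submxMr _ tU) _.
by apply: (mxmoduleP Umod); rewrite inE.
Qed.

(** Split the polytabloid along S = U + W. The operator [kap] sends each part to a multiple of the
    polytabloid, and the two factors add up to the order of the column stabilizer. One of them is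
    nonzero, and that summand contains the polytabloid, which generates S. *)
Lemma specht_simple : mxsimple (tabloid_repr K n) S.
Proof.
have F'G : ([pchar K]^'.-group [set: 'S_n])%g.
  by apply/pgroupP => p _ _; rewrite inE charK0.
have tnz : polytabloid K t != 0.
  by apply: contraNneq polytabloid_row_neq0 => ->; rewrite mul0mx.
split; first exact: specht_module.
  by apply: contraNneq tnz => S0; have := polytabloid_specht; rewrite S0 submx0.
move=> U Umod US nzU; have [W Wmod defS dx] :=
  mx_reducibleS (specht_module K lam) (submx1 _) (mx_Maschke_pchar _ F'G) Umod US.
have /sub_addsmxP[[u w] /= tuw] : (polytabloid K t <= U + W)%MS.
  by rewrite defS polytabloid_specht.
have part_t (x : 'rV_#|T|) : (x <= S)%MS -> exists c, x *m kap = c *: polytabloid K t.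
  by move=> xS; apply/sub_rVP; apply: submx_trans (submxMr _ xS) specht_col_sub.
have WS : (W <= S)%MS by rewrite -defS addsmxSr.
have [c ec] : exists c, u *m U *m kap = c *: polytabloid K t.
  by apply: part_t; apply: mulmx_sub.
have [d ed] : exists d, w *m W *m kap = d *: polytabloid K t.
  by apply: part_t; apply: mulmx_sub.
have cd : c + d != 0.
  have := polytabloid_col; rewrite {1}tuw mulmxDl ec ed -scalerDl => /eqP.
  rewrite -subr_eq0 -scalerBl scaler_eq0 (negbTE tnz) orbF subr_eq0 => /eqP->.
  by rewrite natK_neq0 ?cardG_gt0.
have sub_of (V : 'M_#|T|) (x : 'rV_#|T|) k : mxmodule (tabloid_repr K n) V -> (x <= V)%MS ->
    x *m kap = k *: polytabloid K t -> k != 0 -> (S <= V)%MS.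
  move=> Vmod xV xk knz; apply: (specht_min Vmod).
  rewrite -(eqmx_scale _ knz) -xk; apply: submx_trans (submxMr _ xV) _.
  exact: (mxmodule_gring_sum Vmod).
have [c0|cnz] := eqVneq c 0; last exact: (sub_of _ _ _ Umod (mulmx_sub _ (submx_refl U)) ec cnz).
rewrite c0 add0r in cd.
have SW := sub_of _ _ _ Wmod (mulmx_sub _ (submx_refl W)) ed cd.
case/eqP: nzU; apply/eqP; rewrite -submx0 -(mxdirect_addsP dx) sub_capmx submx_refl.
exact: submx_trans US SW.
Qed.

Lemma specht_irr : mx_irreducible (specht K lam).
Proof. exact/submod_mx_irr/specht_simple. Qed.

End SpechtModule.

Lemma specht_mul_neq0 mu (M : 'M_#|T|) : specht_mx K mu *m M != 0 ->
  exists2 t, is_tableau mu t & polytabloid K t *m M != 0.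
Proof.
move=> nz; have /existsP[t /andP[tP tM]] :
    [exists t, is_tableau mu t && (polytabloid K t *m M != 0)].
  apply: contraNT nz => /existsPn h; rewrite -submx0 sumsmxMr; apply/sumsmx_subP => t tP.
  by rewrite (eqmxMr _ (genmxE _)) submx0; have := h t; rewrite tP /= negbK.
by exists t.
Qed.

(** If [kap] is nonzero on the module of [mu], then [lam] dominates [mu]; if [rho] is, then [mu]
    dominates [lam]. *)
Lemma specht_op_rank_eq0 lam mu t : is_tableau lam t -> lam != mu ->
  op_rank (col_coef t) (row_coef t) (specht K mu) = 0%N.
Proof.
move=> tP nlm; rewrite op_rank_submod; apply/eqP; rewrite mxrank_eq0.
set kap := gring_sum _ _; set rho := gring_sum _ _.
apply: contraNT nlm => nz.
have [nzk nzr] : specht_mx K mu *m kap != 0 /\ specht_mx K mu *m rho != 0.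
  split; first by apply: contraNneq nz => ->; rewrite mul0mx.
  have := submxMr rho (mxmodule_gring_sum (specht_module K mu) (col_coef t)).
  by rewrite -/kap => h; apply: contraNneq nz => z; rewrite z submx0 in h.
have [t1 t1P nz1] := specht_mul_neq0 nzk; have [t2 t2P nz2] := specht_mul_neq0 nzr.
have dom1 r : (r <= n)%N -> (\sum_(i < r) part mu i <= \sum_(i < r) part lam i)%N.
  have /existsP[s nzs] : [exists s, tabloid_vec K (relabel s (tabloid t1)) *m kap != 0].
    apply: contraNT nz1 => /existsPn h; rewrite polytabloid_expand big1 // => s _.
    by have := h s; rewrite negbK => /eqP ->; rewrite scaler0.
  have fmu := content_relabel s (tabloid_tableau_content t1P).
  apply: (content_dominated tP fmu); exact: (tabloid_content_col_sum tP fmu nzs).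
have dom2 r : (r <= n)%N -> (\sum_(i < r) part lam i <= \sum_(i < r) part mu i)%N.
  apply: (@content_dominated _ _ _ t2P lam (fun x => (t x).1) (card_tableau_row tP) _ r).
  (* If x and y share a row of [t] and a column of [t2], their transposition fixes [rho] and negates
     the antisymmetrizer of [t2], so the image of the polytabloid is its own negative. *)
  move=> x y cxy rxy; apply/eqP; apply: contraNT nz2 => nxy; apply/eqP/eqN_eq0.
  have sR : tperm x y \in fiber_stab (row t) by apply/fiber_stabP => i; case: tpermP => // ->.
  have sC : tperm x y \in fiber_stab (col t2) by apply/fiber_stabP => i; case: tpermP => // ->.
  have er := twist_mull (fun _ _ => esym (mulr1 1)) (tabloid_repr K n) sR.
  rewrite scale1r -/(row_coef t) -/rho in er.
  rewrite -{1}er mulmxA tabloid_col_sum -[X in X *m rho]mulmxA.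
  have := twist_mulr sgnM (tabloid_repr K n) sC.
  rewrite /sgn odd_tperm nxy expr1 scaleN1r => ec.
  have {}ec := etrans (esym (opprK _)) (congr1 -%R ec).
  by rewrite ec mulmxN mulNmx.
apply/eqP/part_sum_inj => r rn.
by apply/eqP; rewrite eqn_leq dom1 ?dom2.
Qed.

End Specht.

(** * Young symmetrizers on the subsets of size at least three *)

Lemma card_ord_segment m a b : (b <= m)%N -> #|[set i : 'I_m | (a <= i < b)%N]| = (b - a)%N.
Proof.
move=> bm; have -> : [set i : 'I_m | (a <= i < b)%N] = [set i : 'I_m | (i < b)%N] :\: [set i : 'I_m | (i < a)%N].
  by apply/setP => i; rewrite !inE -leqNgt.
rewrite cardsD card_ltn_ord //.
have -> : [set i : 'I_m | (i < b)%N] :&: [set i : 'I_m | (i < a)%N] = [set i : 'I_m | (i < minn a b)%N].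
  by apply/setP => i; rewrite !inE leq_min andbC.
by rewrite card_ltn_ord; lia.
Qed.

Section RowSegments.
Variables (n : nat) (lam : intpart n) (t : {ffun 'I_n -> 'I_n * 'I_n}).
Hypothesis tP : is_tableau lam t.
Local Notation row x := (val (t x).1).
Local Notation col x := (val (t x).2).
Local Open Scope nat_scope.

Lemma tableau_onto_nat r c : c < part lam r -> exists x, row x = r /\ col x = c.
Proof.
move=> rc; have rn : r < n by rewrite ltnNge; apply/negP => /(part_default lam) r0; rewrite r0 in rc.
have cn : c < n := leq_trans rc (part_leq lam r).
by have [x tx] := tableau_onto tP (r := Ordinal rn) (c := Ordinal cn) rc; exists x; rewrite tx.
Qed.

Lemma tableau_cell_inj x y : row x = row y -> col x = col y -> x = y.
Proof.
move=> /val_inj rxy /val_inj cxy; apply: (tableau_inj tP).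
by move: rxy cxy; case: (t x) (t y) => [a b] [c d] /= -> ->.
Qed.

Lemma card_row_segment r a b : b <= part lam r ->
  #|[set x | (row x == r) && (a <= col x < b)]| = b - a.
Proof.
move=> br; rewrite -(@card_ord_segment n a b) ?(leq_trans br (part_leq _ _)) //.
rewrite -(card_in_imset (f := fun x => (t x).2)) => [|x y]; last first.
  rewrite !inE => /andP[/eqP xr _] /andP[/eqP yr _] e.
  by apply: tableau_cell_inj; rewrite ?xr ?yr ?e.
apply: eq_card => c; rewrite inE; apply/imsetP/idP => [[x]|/andP[ac cb]].
  by rewrite inE => /andP[_ h] ->.
have [x [xr xc]] := tableau_onto_nat (leq_trans cb br).
by exists x; rewrite ?inE ?xr ?xc ?eqxx ?ac //; apply: val_inj.
Qed.
End RowSegments.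

Section BigsetRank.
Variables (K : fieldType) (n : nat).
Hypothesis charK0 : [pchar K] =i pred0.
Local Notation T := (bigset n).
Local Notation N := (perm_module K (@bigset_act1 n) (@bigset_actM n)).
Variables (lam : intpart n) (t : {ffun 'I_n -> 'I_n * 'I_n}).
Hypothesis tP : is_tableau lam t.
Local Notation row x := (val (t x).1).
Local Notation col x := (val (t x).2).
Local Notation kap := (gring_sum (col_coef K t) N).
Local Notation rho := (gring_sum (row_coef K t) N).
Local Notation delta U := (delta_mx 0 (enum_rank U) : 'rV[K]_#|{: T}|).

Lemma col_stab_tperm x y : col x = col y -> tperm x y \in fiber_stab (fun x => (t x).2).
Proof. by move=> /val_inj e; apply/fiber_stabP => i; case: tpermP => // ->. Qed.

Lemma row_stab_tperm x y : row x = row y -> tperm x y \in fiber_stab (fun x => (t x).1).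
Proof. by move=> /val_inj e; apply/fiber_stabP => i; case: tpermP => // ->. Qed.

Lemma tperm_imset (x y : 'I_n) (U : {set 'I_n}) : (x \in U) = (y \in U) -> tperm x y @: U = U.
Proof.
move=> e; apply/setP => i; rewrite -[i](tpermK x y) mem_imset; last exact: perm_inj.
by rewrite tpermK; case: tpermP => // ->.
Qed.

Lemma bigset_act_tperm x y (U : T) : (x \in val U) = (y \in val U) ->
  bigset_act U (tperm x y) = U.
Proof. by move=> e; apply: val_inj; rewrite /= tperm_imset. Qed.

Lemma kap_mulr x y : x != y -> col x = col y -> kap *m N (tperm x y) = - kap.
Proof.
move=> nxy cxy; have := twist_mulr (@sgnM K n) N (col_stab_tperm cxy).
rewrite {1}/sgn odd_tperm nxy expr1 scaleN1r -/(col_coef K t) => e.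
by rewrite -[X in _ = - X]e opprK.
Qed.

Lemma kap_mull x y : x != y -> col x = col y -> N (tperm x y) *m kap = - kap.
Proof.
move=> nxy cxy; have := twist_mull (@sgnM K n) N (col_stab_tperm cxy).
rewrite {1}/sgn odd_tperm nxy expr1 scaleN1r -/(col_coef K t) => e.
by rewrite -[X in _ = - X]e opprK.
Qed.

(** Among three entries of the first column two are both inside or both outside a given set; their
    transposition fixes the set and negates [kap]. *)
Lemma op_rank_bigset_tall : (0 < part lam 2)%N ->
  op_rank (col_coef K t) (row_coef K t) N = 0%N.
Proof.
move=> l2; suff kap0 : kap = 0 by rewrite /op_rank kap0 mul0mx mxrank0.
have p0 r : (r <= 2)%N -> (0 < part lam r)%N.
  by move=> r2; apply: leq_trans l2 (part_mono lam r2).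
have [x0 [r0 c0]] := tableau_onto_nat tP (p0 0%N isT).
have [x1 [r1 c1]] := tableau_onto_nat tP (p0 1%N isT).
have [x2 [r2 c2]] := tableau_onto_nat tP (p0 2%N isT).
have kill (x y : 'I_n) (U : T) : row x != row y -> col x = col y ->
    (x \in val U) = (y \in val U) -> delta U *m kap = 0.
  move=> rxy cxy e; have nxy : x != y by apply: contraNneq rxy => ->.
  apply: (eqN_eq0 charK0); rewrite -mulmxN -(kap_mull nxy cxy) mulmxA.
  by rewrite delta_perm_module bigset_act_tperm.
apply/row_matrixP => i; rewrite rowE row0 -(enum_valK i).
set U := enum_val i; case: (eqVneq (x0 \in val U) (x1 \in val U)) => [|n01].
  by apply: kill; rewrite ?r0 ?r1 ?c0 ?c1.
case: (eqVneq (x0 \in val U) (x2 \in val U)) => [|n02].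
  by apply: kill; rewrite ?r0 ?r2 ?c0 ?c2.
apply: (kill x1 x2); rewrite ?r1 ?r2 ?c1 ?c2 //.
by move: n01 n02; do 3!case: (_ \in _).
Qed.

Lemma perm_module_tr s : (N s)^T = N s^-1%g.
Proof.
apply/row_matrixP => i; apply/rowP => j; rewrite !mxE -(enum_valK i) -(enum_valK j).
rewrite !enum_rankK !eqxx /= !(inj_eq enum_rank_inj); congr (nat_of_bool _)%:R.
apply/eqP/eqP => ->; first by rewrite -bigset_actM mulgV bigset_act1.
by rewrite -bigset_actM mulVg bigset_act1.
Qed.

Lemma twist_tr g (e : 'S_n -> K) : (forall s, e s^-1%g = e s) ->
  (gring_sum (twist g e) N)^T = gring_sum (twist g e) N.
Proof.
move=> eV; rewrite !gring_sum_twist linear_sum (reindex_inj invg_inj) /=.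
apply: eq_big => s; first by rewrite groupV.
by rewrite linearZ /= perm_module_tr invgK eV.
Qed.

(** Permutation matrices are orthogonal, so transposition reverses the product. With [kap] applied
    last, the image consists of column-antisymmetric vectors. *)
Lemma op_rank_bigset_tr :
  op_rank (col_coef K t) (row_coef K t) N = \rank (rho *m kap).
Proof.
rewrite /op_rank -mxrank_tr trmx_mul; congr (\rank (_ *m _)); apply: twist_tr => // s.
by rewrite /sgn odd_permV.
Qed.

Section TwoRows.
Hypothesis two_rows : part lam 2 = 0%N.
Local Notation j := (part lam 1).

Lemma tableau_row_lt2 x : (row x < 2)%N.
Proof.
rewrite ltnNge; apply/negP => /(part_mono lam); rewrite two_rows leqn0 => /eqP e.
by have := tableau_col tP x; rewrite e.
Qed.

Lemma part0E : (part lam 0 + j = n)%N.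
Proof.
(* The two extra zero terms allow the first two parts to be split off even when n < 2. *)
have : (\sum_(r < n.+2) part lam r = n)%N.
  by rewrite !big_ord_recr /= part_sum !part_default // !addn0.
rewrite !big_ord_recl /= big1 ?addn0 // => i _; apply/eqP.
by have := @part_mono _ lam 2 (bump 0 (bump 0 i)) isT; rewrite two_rows leqn0.
Qed.

Lemma part1_leq0 : (j <= part lam 0)%N. Proof. exact: part_mono. Qed.

Lemma tableau_row_col_lt x : row x = 1%N -> (col x < j)%N.
Proof. by move=> xr; have := tableau_col tP x; rewrite xr. Qed.

Lemma tableau_row_col_ge x : (j <= col x)%N -> row x = 0%N.
Proof.
move=> jx; have := tableau_row_lt2 x; case e: (row x) => [|[|m]] //= _.
by have := tableau_row_col_lt e; rewrite ltnNge jx.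
Qed.

Lemma tableau_col_lt x : (col x < part lam 0)%N.
Proof. by apply: leq_trans (tableau_col tP x) (part_mono lam _). Qed.

(* The second row together with k - j cells of the first row that lie outside of the
   columns with two cells. *)
Definition model_set k : {set 'I_n} :=
  [set x | (row x == 1%N) || ((row x == 0%N) && (j <= col x < k)%N)].

Lemma card_model_set k : (j <= k <= part lam 0)%N -> #|model_set k| = k.
Proof.
move=> /andP[jk k0].
have -> : model_set k = [set x | (row x == 1%N) && (0 <= col x < j)%N] :|:
    [set x | (row x == 0%N) && (j <= col x < k)%N].
  apply/setP => x; rewrite !inE; congr orb; case: eqP => //= /tableau_row_col_lt ->//.
rewrite cardsU !(card_row_segment tP) // subn0 [_ :&: _](_ : _ = set0) ?cards0; first by lia.
by apply/setP => x; rewrite !inE; case: eqP => // ->; rewrite andbF.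
Qed.

Lemma col_stab_single (s : 'S_n) x : s \in fiber_stab (fun x => (t x).2) ->
  (j <= col x)%N -> s x = x.
Proof.
move=> /fiber_stabP sC jx; apply: (tableau_cell_inj tP); last by rewrite sC.
by rewrite !tableau_row_col_ge // sC.
Qed.

Section Image.
Variables (v z : 'rV[K]_#|{: T}|).
Hypothesis zE : z = v *m (rho *m kap).
Local Notation coef U := (z 0 (enum_rank (U : T))).

Lemma image_tperm_col x y U : x != y -> col x = col y ->
  coef (bigset_act U (tperm x y)) = - coef U.
Proof.
move=> nxy cxy; have e : z *m N (tperm x y) = - z.
  by rewrite zE -!mulmxA (kap_mulr nxy cxy) !mulmxN.
by rewrite -(mul_perm_module (@bigset_act1 n) (@bigset_actM n) z (tperm x y) U) e mxE opprK.
Qed.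

(** Column permutations fix x and y, which are alone in their columns, so the transposition commutes
    with [kap]; as x and y lie in the first row, [rho] then absorbs it. *)
Lemma image_tperm_single x y U : x != y -> (j <= col x)%N -> (j <= col y)%N ->
  coef (bigset_act U (tperm x y)) = coef U.
Proof.
move=> nxy jx jy; have e : z *m N (tperm x y) = z.
  have kC : kap *m N (tperm x y) = N (tperm x y) *m kap.
    rewrite gring_sum_twist mulmx_suml mulmx_sumr; apply: eq_bigr => s sC.
    rewrite -scalemxAl -scalemxAr -!repr_mxM ?inE //; congr (_ *: N _).
    by rewrite [RHS]conjgC tpermJ !col_stab_single // groupV.
  have sR : tperm x y \in fiber_stab (fun x => (t x).1).
    by apply: row_stab_tperm; rewrite !tableau_row_col_ge.
  have := twist_mulr (fun _ _ => esym (mulr1 (1 : K))) N sR.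
  rewrite scale1r -/(row_coef K t) => rR.
  by rewrite zE -!mulmxA kC (mulmxA rho) rR.
by rewrite -(mul_perm_module (@bigset_act1 n) (@bigset_actM n) z (tperm x y) U) e.
Qed.

Lemma image_pair x y (U : T) : coef U != 0 -> x != y -> col x = col y ->
  (x \in val U) = (y \notin val U).
Proof.
move=> nz nxy cxy; apply/eqP; apply: contraNT nz => h.
apply/eqP/(@eqN_eq0 K charK0 K^o); rewrite -(image_tperm_col _ nxy cxy) bigset_act_tperm //.
by move: h; do 2!case: (_ \in _).
Qed.

(** A set in the support has exactly one entry in each of the [j] columns with two cells and at most
    one in any column. *)
Lemma image_card (U : T) : coef U != 0 -> (j <= #|val U| <= part lam 0)%N.
Proof.
move=> nz; have colU : {in val U &, injective (fun x => (t x).2)}.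
  move=> x y xU yU cxy; apply/eqP; apply: contraTT yU => nxy.
  by rewrite -(image_pair nz nxy) ?cxy.
rewrite -(card_in_imset colU); apply/andP; split.
  rewrite -(@card_ltn_ord n j) ?part_leq //; apply/subset_leq_card/subsetP => c.
  rewrite inE => cj; apply/imsetP.
  have [x [xr xc]] := tableau_onto_nat tP cj.
  have [y [yr yc]] := tableau_onto_nat tP (leq_trans cj part1_leq0).
  have nxy : x != y by apply: contra_eq_neq xr => ->; rewrite yr.
  have := image_pair nz nxy (etrans xc (esym yc)).
  by case: (boolP (y \in val U)) => yU xU; [exists y | exists x] => //; apply: val_inj.
rewrite -[X in (_ <= X)%N](@card_ltn_ord n) ?part_leq //.
by apply/subset_leq_card/subsetP => _ /imsetP[x _ ->]; rewrite inE tableau_col_lt.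
Qed.

(** The transpositions above change coefficients only by a sign and lead from any set in the support
    to the model set of the same size. The induction is on the number of elements outside that model
    set. *)
Lemma image_eq0 :
  (forall U : T, (j <= #|val U| <= part lam 0)%N -> val U = model_set #|val U| -> coef U = 0) ->
  z = 0.
Proof.
move=> model0; suff h U : coef U = 0.
  by apply/rowP => i; rewrite -(enum_valK i) h mxE.
have [d] := ubnP #|val U :\: model_set #|val U| |; elim: d U => // d IHd U; rewrite ltnS => dU.
have [//|nz] := eqVneq (coef U) 0; have cU := image_card nz.
set k := #|val U| in dU cU; set M := model_set k in dU.
have cM : #|M| = k by apply: card_model_set.
have [UM|/subsetPn[x xU xM]] := boolP (val U \subset M).
  by apply: model0 => //; apply/eqP; rewrite eqEcard -/k -/M UM cM leqnn.
suff [[x' y'] /= [x'U x'M y'U y'M e]] : exists p : 'I_n * 'I_n, [/\ p.1 \in val U, p.1 \notin M,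
    p.2 \notin val U, p.2 \in M & coef (bigset_act U (tperm p.1 p.2)) = 0 -> coef U = 0].
  apply: e; apply: IHd => /=.
  have -> : #|tperm x' y' @: val U| = k by rewrite card_imset //; apply: perm_inj.
  rewrite -/M; apply: leq_trans dU; apply: proper_card; apply/properP; split; last first.
    have xs : (x' \in tperm x' y' @: val U) = (y' \in val U).
      by rewrite -{1}(tpermR x' y') mem_imset //; apply: perm_inj.
    by exists x'; rewrite in_setD x'M // xs.
  apply/subsetP => i; rewrite !in_setD => /andP[iM]; rewrite iM -[i in X in X -> _](tpermK x' y').
  rewrite mem_imset; last exact: perm_inj.
  by case: tpermP => // [ix|iy]; [rewrite (negbTE y'U) | rewrite iy y'M in iM].
have pairE x1 y1 : row x1 = 0%N -> row y1 = 1%N -> col x1 = col y1 -> x1 \in val U ->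
    exists p : 'I_n * 'I_n, [/\ p.1 \in val U, p.1 \notin M,
    p.2 \notin val U, p.2 \in M & coef (bigset_act U (tperm p.1 p.2)) = 0 -> coef U = 0].
  move=> x1r y1r c1 x1U; have n1 : x1 != y1 by apply: contra_eq_neq y1r => <-; rewrite x1r.
  exists (x1, y1); split=> //=.
  - by rewrite !inE x1r /= c1 negb_and -ltnNge tableau_row_col_lt.
  - by rewrite -(image_pair nz n1 c1).
  - by rewrite inE y1r.
  by rewrite image_tperm_col // => /eqP; rewrite oppr_eq0 => /eqP.
have xr : row x = 0%N.
  have := tableau_row_lt2 x; move: xM; rewrite !inE negb_or => /andP[r1 _].
  by move: r1; case: (row x) => [|[|]].
have [xj|jx] := ltnP (col x) j.
  by have [y [yr yc]] := tableau_onto_nat tP xj; apply: (pairE x y).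
(* Here x is alone in its column. If y is too, x and y are exchanged; if y is in the second row, it
   is exchanged with the entry above it, which belongs to U. *)
have [y yM yU] : exists2 y, y \in M & y \notin val U.
  apply/subsetPn; apply: contraNN xM => MU; suff -> : M = val U by [].
  by apply/eqP; rewrite eqEcard MU cM leqnn.
have: (row y == 1%N) || ((row y == 0%N) && (j <= col y < k)%N) by rewrite inE in yM.
case/orP => [/eqP yr|/and3P[_ jy _]].
  have [x1 [x1r x1c]] := tableau_onto_nat tP (leq_trans (tableau_row_col_lt yr) part1_leq0).
  have n1 : x1 != y by apply: contra_eq_neq yr => <-; rewrite x1r.
  by apply: (pairE x1 y) => //; rewrite (image_pair nz n1 x1c).
exists (x, y); split=> //=; rewrite image_tperm_single //.
by apply: contraNneq xM => ->.
Qed.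

End Image.
Definition model_index := {k : 'I_n.+1 | (2 < k)%N && (j <= k <= part lam 0)%N}.
HB.instance Definition _ := Finite.on model_index.

Lemma model_bigset_proof (k : model_index) : (2 < #|model_set (val k)|)%N.
Proof. by have /andP[k2 kj] := valP k; rewrite card_model_set. Qed.
Definition model_bigset (k : model_index) : T :=
  exist (fun S : {set 'I_n} => (2 < #|S|)%N) _ (model_bigset_proof k).

Lemma card_model_bigset k : #|val (model_bigset k)| = val k.
Proof. by have /andP[k2 kj] := valP k; rewrite card_model_set. Qed.

(** Row permutations keep the second row inside the set, and a model set meets the two-cell columns
    only in the second row. So only the column permutation 1 contributes, and the coefficient counts
    row permutations: none if the sizes differ, at least the identity if they agree. *)
Lemma model_coef (k l : model_index) :
  (delta (model_bigset k) *m (rho *m kap)) 0 (enum_rank (model_bigset l)) = 0 <-> k != l.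
Proof.
rewrite mulmxA [rho]gring_sum_twist [X in X *m _]mulmx_sumr mulmx_suml summxE.
have coefE (r s : 'S_n) : (delta (model_bigset k) *m N r *m N s) 0 (enum_rank (model_bigset l)) =
    (s @: (r @: model_set (val k)) == model_set (val l))%:R.
  by rewrite !delta_perm_module mxE eqxx /= (inj_eq enum_rank_inj) eq_sym.
rewrite (eq_bigr (fun r : 'S_n => (r @: model_set (val k) == model_set (val l))%:R : K)); last first.
  move=> r /fiber_stabP rR; rewrite scale1r gring_sum_twist mulmx_sumr summxE.
  rewrite (bigD1 1%g) ?group1 //= big1 ?addr0 => [|s /andP[sC ns]].
    rewrite -scalemxAr mxE coefE /sgn odd_perm1 expr0 mul1r.
    by congr (nat_of_bool (_ == _))%:R; rewrite -[RHS]imset_id; apply: eq_imset => x; rewrite perm1.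
  rewrite -scalemxAr mxE coefE; case: eqP => [e|]; last by rewrite mulr0.
  have s1 x : row x = 1%N -> s x = x.
    move=> xr; have xm : x \in r @: model_set (val k).
      rewrite -[x](permKV r) mem_imset; last exact: perm_inj.
      by rewrite inE -rR permKV xr.
    have : s x \in model_set (val l) by rewrite -e mem_imset //; apply: perm_inj.
    rewrite inE => /orP[/eqP sr|/and3P[_ js _]].
      by apply: (tableau_cell_inj tP); rewrite ?sr ?xr // (fiber_stabP _ s sC).
    by rewrite (fiber_stabP _ s sC) leqNgt tableau_row_col_lt in js.
  case/eqP: ns; apply/permP => x; rewrite perm1.
  have [jx|xj] := leqP j (col x); first exact: col_stab_single.
  have := tableau_row_lt2 x; case xr: (row x) => [|[|]] // _; last exact: s1.
  have := tableau_row_lt2 (s x); case sr: (row (s x)) => [|[|]] // _.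
    by apply: (tableau_cell_inj tP); rewrite ?sr ?xr // (fiber_stabP _ s sC).
  by apply: (@perm_inj _ s); rewrite s1.
split=> [|nkl]; last first.
  rewrite big1 // => r _; case: eqP => // e; case/eqP: nkl; apply/val_inj/val_inj.
  by rewrite /= -!card_model_bigset /= -e card_imset //; apply: perm_inj.
apply: contraPneq => <-; rewrite -natr_sum; apply/eqP/(natK_neq0 charK0).
rewrite (bigD1 1%g) ?group1 //= (_ : _ @: _ = model_set (val k)) ?eqxx //.
by rewrite -[RHS]imset_id; apply: eq_imset => x; rewrite perm1.
Qed.

(** By [image_eq0] restriction to the model sets is injective on the image, which bounds the rank
    above; the minor of E at the model sets is diagonal and invertible, which bounds it below. *)
Lemma op_rank_bigset_two_rows : op_rank (col_coef K t) (row_coef K t) N = #|{: model_index}|.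
Proof.
rewrite op_rank_bigset_tr; set E := rho *m kap.
pose P : 'M[K]_(#|{: model_index}|, #|{: T}|) := \matrix_i delta (model_bigset (enum_val i)).
have mulPT m (A : 'M_(m, _)) i k : (A *m P^T) i k = A i (enum_rank (model_bigset (enum_val k))).
  rewrite mxE (bigD1 (enum_rank (model_bigset (enum_val k)))) //= big1 ?addr0 => [|l nl].
    by rewrite !mxE !eqxx mulr1.
  by rewrite !mxE eqxx /= (negbTE nl) mulr0.
have cap0 : (E :&: kermx P^T)%MS = 0.
  apply/eqP/rowV0P => z; rewrite sub_capmx => /andP[/submxP[v zE] /sub_kermxP zP].
  apply: (image_eq0 zE) => U cU UM.
  have cn : (#|val U| < n.+1)%N by have := max_card (mem (val U)); rewrite card_ord.
  have kP : (2 < Ordinal cn)%N && (j <= Ordinal cn <= part lam 0)%N by rewrite cU andbT; apply: (valP U).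
  pose k : model_index := exist (fun k : 'I_n.+1 => (2 < k)%N && (j <= k <= part lam 0)%N) _ kP.
  have -> : U = model_bigset k by apply: val_inj.
  by have := mulPT _ z 0 (enum_rank k); rewrite zP enum_rankK mxE.
rewrite -(mxrank_mul_ker E P^T) cap0 mxrank0 addn0; apply/eqP; rewrite eqn_leq rank_leq_col /=.
apply: leq_trans (mxrankM_maxr P _); rewrite -[X in (X <= _)%N](mxrank1 K).
have rowE' m1 m2 (A : 'M[K]_(m1, m2)) i k : A i k = matrix.row i A 0 k by rewrite mxE.
pose d := \row_i (P *m (E *m P^T)) i i.
have dE : P *m (E *m P^T) = diag_mx d.
  apply/matrixP => i k; rewrite [RHS]mxE; case: eqP => [->|nik]; first by rewrite mulr1n [RHS]mxE.
  by rewrite mulr0n mulmxA mulPT rowE' row_mul rowK; apply/model_coef/eqP => /enum_val_inj.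
have u : P *m (E *m P^T) \in unitmx.
  rewrite unitmxE dE det_diag unitfE; apply/prodf_neq0 => i _; rewrite mxE mulmxA mulPT.
  by rewrite rowE' row_mul rowK; apply/eqP => /model_coef; rewrite eqxx.
by rewrite mxrank1 (mxrank_unit u).
Qed.

(** The sizes range from [maxn 3 j] to n - [j]; at [j] = 3 both branches give n - 5, and truncation
    accounts for an empty range. *)
Lemma card_model_index : #|{: model_index}| = two_row_mult n j.
Proof.
rewrite card_sub -(eq_card (A := [set k : 'I_n.+1 | maxn 3 j <= k < (part lam 0).+1]%N)).
  have jn := part_leq lam 0; have e := part0E; have le := part1_leq0.
  rewrite card_ord_segment // /two_row_mult; case: leqP => h; lia.
by move=> k; rewrite !inE geq_max ltnS andbA.
Qed.

Lemma op_rank_bigset_two_row_mult :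
  op_rank (col_coef K t) (row_coef K t) N = two_row_mult n j.
Proof. by rewrite op_rank_bigset_two_rows card_model_index. Qed.

End TwoRows.
End BigsetRank.

(** * Cycle types *)

Section CycleType.
Local Open Scope nat_scope.
Variable n : nat.
Implicit Types (s u : 'S_n).
Local Notation order := fingraph.order.

Lemma froot_eq s x y : (froot s x == froot s y) = fconnect s x y.
Proof. by rewrite root_connect //; apply/fconnect_sym/perm_inj. Qed.

Lemma froot_perm s x : froot s (s x) = froot s x.
Proof.
by apply/eqP; rewrite froot_eq (fconnect_sym (@perm_inj _ s)) fconnect1.
Qed.

Lemma fconnect_froot s x : fconnect s (froot s x) x.
Proof. by rewrite (fconnect_sym (@perm_inj _ s)) connect_root. Qed.

Lemma froot_iter s x i : froot s (iter i s x) = froot s x.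
Proof. by elim: i => //= i IHi; rewrite froot_perm. Qed.

Definition cycle_reps s m : {set 'I_n} := [set x | (froot s x == x) && (order s x == m)].
(* These are the parts of the conjugate of the cycle type, which need no sorting. *)
Definition long_cycles s r := #|[set x : 'I_n | (froot s x == x) && (r < order s x)]|.

Lemma long_cycles_leq s r : long_cycles s r < n.+1.
Proof. by rewrite ltnS -[X in _ <= X]card_ord max_card. Qed.

Lemma order_leq s x : order s x <= n.
Proof. by rewrite -[X in _ <= X](card_ord n) max_card. Qed.

Lemma long_cycles_split s r : long_cycles s r = #|cycle_reps s r.+1| + long_cycles s r.+1.
Proof.
rewrite /long_cycles -[LHS](cardsID [set x | order s x == r.+1]); congr (_ + _); apply: eq_card => x.
  rewrite !inE -andbA; congr andb.
  by case: (order s x =P r.+1) => [->|]; rewrite ?andbF ?ltnSn.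
rewrite !inE andbCA; congr andb.
by rewrite [RHS]ltn_neqAle eq_sym.
Qed.

Lemma cycle_reps_card s u : (forall r, r < n -> long_cycles s r = long_cycles u r) ->
  forall m, #|cycle_reps s m| = #|cycle_reps u m|.
Proof.
have gt_n v r : n <= r -> long_cycles v r = 0.
  move=> nr; apply: eq_card0 => x; rewrite !inE ltnNge (leq_trans (order_leq v x) nr).
  by rewrite andbF.
move=> e [|m]; last first.
  have eL r : long_cycles s r = long_cycles u r.
    by have [/e//|nr] := ltnP r n; rewrite !gt_n.
  by have := eL m; rewrite (long_cycles_split s) (long_cycles_split u) eL => /addIn.
by rewrite !eq_card0 // => x; rewrite !inE eqn0Ngt fingraph.order_gt0 andbF.
Qed.

(** Double counting: a cycle of length m is counted once for every r < m. *)
Lemma long_cycles_sum s : \sum_(r < n) long_cycles s r = n.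
Proof.
rewrite /long_cycles; under eq_bigr do rewrite -sum1_card.
rewrite -[RHS]card_ord -[RHS]sum1_card.
rewrite [RHS](partition_big (froot s) (fun x => froot s x == x)) /=; last first.
  by move=> x _; rewrite root_root //; apply/fconnect_sym/perm_inj.
rewrite (exchange_big_dep (fun x => froot s x == x)) /=; last by move=> r x _; rewrite inE => /andP[].
apply: eq_bigr => x rx; rewrite !sum1_card.
transitivity (order s x).
  rewrite -[RHS](card_ltn_ord (order_leq s x)); apply: eq_card => r; rewrite [RHS]inE.
  transitivity (x \in [set y | (froot s y == y) && (r < order s y)]) => //.
  by rewrite inE rx.
apply: eq_card => y; transitivity (froot s y == x) => //.
by rewrite -{2}(eqP rx) froot_eq (fconnect_sym (@perm_inj _ s)).
Qed.

Definition cycle_parts s : n.-tuple 'I_n.+1 := [tuple Ordinal (long_cycles_leq s r) | r < n].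

Lemma cycle_type_proof s :
  sorted geq [seq val i | i <- cycle_parts s] && (sumn [seq val i | i <- cycle_parts s] == n).
Proof.
have pE : [seq val i | i <- cycle_parts s] = [seq long_cycles s r | r <- iota 0 n].
  by rewrite -val_enum_ord -!map_comp; apply: eq_map.
rewrite pE; apply/andP; split.
  apply: (homo_sorted (e := leq)) (iota_sorted 0 n) => i j ij /=.
  apply/subset_leq_card/subsetP => x; rewrite !inE => /andP[-> jx] /=.
  exact: leq_ltn_trans ij jx.
by rewrite sumnE big_map -[X in iota 0 X]subn0 -/(index_iota 0 n) big_mkord long_cycles_sum.
Qed.

Definition cycle_type s : intpart n := IntPart (cycle_type_proof s).

Lemma cycle_type_long_cycles s u : cycle_type s = cycle_type u ->
  forall r, r < n -> long_cycles s r = long_cycles u r.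
Proof.
move=> /(congr1 (@parts n)) e r rn.
have : tnth (cycle_parts s) (Ordinal rn) = tnth (cycle_parts u) (Ordinal rn).
  exact: (congr1 (fun p => tnth p (Ordinal rn)) e).
have tE v : tnth (cycle_parts v) (Ordinal rn) = Ordinal (long_cycles_leq v r).
  exact: tnth_mktuple.
by rewrite !tE => /(congr1 val).
Qed.

Section Conjugation.
Variables (s u : 'S_n).
Hypothesis reps_card : forall m, #|cycle_reps s m| = #|cycle_reps u m|.

Definition match_rep x :=
  nth x (enum (cycle_reps u (order s x))) (index x (enum (cycle_reps s (order s x)))).

Lemma match_repP x : froot s x == x ->
  (froot u (match_rep x) == match_rep x) && (order u (match_rep x) == order s x).
Proof.
move=> rx; have xE : x \in cycle_reps s (order s x) by rewrite inE rx eqxx.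
have : match_rep x \in enum (cycle_reps u (order s x)).
  by rewrite mem_nth // -cardE -reps_card cardE index_mem mem_enum.
by rewrite mem_enum inE.
Qed.

Lemma match_rep_inj x y : froot s x == x -> froot s y == y -> match_rep x = match_rep y -> x = y.
Proof.
move=> rx ry e; have [_ /eqP ox] := andP (match_repP rx); have [_ /eqP oy] := andP (match_repP ry).
have oxy : order s y = order s x by rewrite -oy -ox e.
have xE : x \in enum (cycle_reps s (order s x)) by rewrite mem_enum inE rx eqxx.
have yE : y \in enum (cycle_reps s (order s x)) by rewrite mem_enum inE ry oxy eqxx.
have yi : index y (enum (cycle_reps s (order s x))) < size (enum (cycle_reps u (order s x))).
  by rewrite -cardE -reps_card cardE index_mem.
move: e; rewrite /match_rep oxy (set_nth_default x) // => /eqP.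
rewrite nth_uniq ?enum_uniq // -?cardE -?reps_card ?cardE ?index_mem // => /eqP e.
by rewrite -(nth_index x xE) e nth_index.
Qed.

(** Cycles of equal length are matched through their representatives, and the i-th iterate of s at
    one is sent to the i-th iterate of u at the other. *)
Definition conj_fun x := iter (findex s (froot s x) x) u (match_rep (froot s x)).

Lemma froot_idem x : froot s (froot s x) == froot s x.
Proof. by rewrite froot_eq fconnect_froot. Qed.

Lemma findex_lt x : findex s (froot s x) x < order u (match_rep (froot s x)).
Proof.
have [_ /eqP ->] := andP (match_repP (froot_idem x)).
exact/findex_max/fconnect_froot.
Qed.

Lemma conj_fun_inj : injective conj_fun.
Proof.
move=> x y e; have rxy : froot s x = froot s y.
  apply: match_rep_inj; rewrite ?froot_idem //.
  have [/eqP <- _] := andP (match_repP (froot_idem x)).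
  have [/eqP <- _] := andP (match_repP (froot_idem y)).
  by move: (congr1 (froot u) e); rewrite /conj_fun !froot_iter.
have lx := findex_lt x; have ly := findex_lt y; move: e; rewrite /conj_fun.
rewrite rxy in lx *; move=> /(congr1 (findex u (match_rep (froot s y)))).
rewrite !findex_iter // => e.
by rewrite -(iter_findex (fconnect_froot s x)) rxy e iter_findex ?fconnect_froot.
Qed.

Lemma conj_fun_perm x : conj_fun (s x) = u (conj_fun x).
Proof.
rewrite /conj_fun froot_perm -iterS; set r := froot s x; set a := findex s r x.
have rx : iter a s r = x by rewrite iter_findex ?fconnect_froot.
have [_ /eqP ou] := andP (match_repP (froot_idem x)); rewrite -/r in ou.
have al : a < order s r by apply/findex_max/fconnect_froot.
(* At the end of a cycle both sides return to the representative, because matched cycles have the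
   same length. *)
rewrite -[in LHS]rx -iterS; have [e|ne] := eqVneq a.+1 (order s r).
  rewrite e iter_order ?findex0 /= -?ou ?iter_order //; exact: perm_inj.
by rewrite findex_iter // ltn_neqAle ne.
Qed.

Lemma conj_exists : exists w, u = (s ^ w)%g.
Proof.
exists (perm conj_fun_inj); apply/permP => x.
set w := perm conj_fun_inj; have wE y : w y = conj_fun y by rewrite permE.
by rewrite -[x](permKV w) permJ !wE conj_fun_perm.
Qed.

End Conjugation.

Lemma card_classes_leq : #|classes [set: 'S_n]| <= #|{: intpart n}|.
Proof.
have inj : {in classes [set: 'S_n] &, injective (fun C => cycle_type (repr C))}.
  move=> _ _ /imsetP[s _ ->] /imsetP[u _ ->].
  move=> /cycle_type_long_cycles/cycle_reps_card/conj_exists[w e].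
  have [v1 _ e1] := repr_class [set: 'S_n]%G s; have [v2 _ e2] := repr_class [set: 'S_n]%G u.
  apply: class_eqP; apply/imsetP; exists (v2 * (v1 * w)^-1)%g; first by rewrite inE.
  by rewrite conjgM -e2 e e1 -!conjgM mulgA mulgV conjg1.
by rewrite -(card_in_imset inj) max_card.
Qed.

End CycleType.

(** * Assembly of the decomposition *)

Lemma repr_iso_rsim (K : fieldType) (gT : finGroupType) (G : {group gT}) (V : lmodType K)
    (act : gT -> V -> V) (r1 r2 : representation K G) :
  repr_iso act r1 -> mx_rsim r1 r2 -> repr_iso act r2.
Proof.
case: r1 r2 => n1 r1 [n2 r2] [f [bij_f homf]] [B /= e]; case: n2 / e r2 B => r2 B.
rewrite row_free_unit => uB homB.
exists (mulmxr B \o f); split.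
  by apply: bij_comp bij_f; exists (mulmxr (invmx B)) => v; rewrite /= ?mulmxK ?mulmxKV.
by move=> s v sG; rewrite /= homf // -!mulmxA homB.
Qed.

Section Assembly.
Variables (K : closedFieldType) (n : nat).
Hypothesis charK0 : [pchar K] =i pred0.

Definition tableau_of (lam : intpart n) := xchoose (exists_tableau lam).
Lemma tableau_ofP lam : is_tableau lam (tableau_of lam).
Proof. exact: xchooseP. Qed.

Local Notation col_of lam := (col_coef K (tableau_of lam)).
Local Notation row_of lam := (row_coef K (tableau_of lam)).

Lemma specht_op_rankE lam mu :
  op_rank (col_of mu) (row_of mu) (specht K lam) = (lam == mu).
Proof.
case: eqVneq => [->|nlm]; first exact: (specht_op_rank charK0 (tableau_ofP mu)).
by apply: (specht_op_rank_eq0 charK0 (tableau_ofP mu)); rewrite eq_sym.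
Qed.

Lemma op_rank_bigset lam :
  op_rank (col_of lam) (row_of lam) (bigset_repr K n) =
  if at_most_two_parts lam then two_row_mult n (part lam 1) else 0%N.
Proof.
case: ifP => [/eqP l2|/negbT]; first exact: (op_rank_bigset_two_row_mult charK0 (tableau_ofP lam)).
by rewrite -lt0n => /(op_rank_bigset_tall charK0 (tableau_ofP lam)).
Qed.

Lemma op_rank_specht_sum (P : pred (intpart n)) (m : intpart n -> nat) mu :
  op_rank (col_of mu) (row_of mu)
    (\big[@dadd_grepr _ _ _/grepr0]_(lam | P lam) muln_grepr (specht K lam) (m lam))
  = if P mu then m mu else 0%N.
Proof.
rewrite op_rank_big big_mkcond (bigD1 mu) //= big1 ?addn0 => [|lam nlm].
  by case: ifP => // _; rewrite op_rank_muln specht_op_rankE eqxx muln1.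
by case: ifP => // _; rewrite op_rank_muln specht_op_rankE (negbTE nlm) muln0.
Qed.

Lemma regular_bigset_rsim :
  mx_rsim (dadd_grepr (regular_grepr K n) (bigset_repr K n))
    (dadd_grepr
       (\big[@dadd_grepr _ _ _/grepr0]_(lam : intpart n)
           muln_grepr (specht K lam) (rdegree (specht K lam)))
       (\big[@dadd_grepr _ _ _/grepr0]_(lam : intpart n | at_most_two_parts lam)
           muln_grepr (specht K lam) (two_row_mult n (part lam 1)))).
Proof.
have F'G : ([pchar K]^'.-group [set: 'S_n])%g by apply/pgroupP => p _ _; rewrite inE charK0.
have irrS lam := specht_irr charK0 (tableau_ofP lam).
apply: (eq_op_rank_rsim F'G irrS specht_op_rankE (card_classes_leq n)) => lam.
rewrite !op_rank_dadd !op_rank_specht_sum op_rank_bigset.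
by rewrite (op_rank_regular F'G irrS specht_op_rankE (card_classes_leq n)).
Qed.

End Assembly.

Local Close Scope na_scope.
Local Close Scope ring_scope.

Theorem theorem2p4 (K : closedFieldType) (charK0 : [pchar K]%R =i pred0)
    (n : nat) (n_gt0 : 0 < n) :
  repr_iso (@multilinear_act K n)
    (dadd_grepr
       (\big[@dadd_grepr _ _ _/grepr0]_(lam : intpart n)
           muln_grepr (specht K lam) (rdegree (specht K lam)))
       (\big[@dadd_grepr _ _ _/grepr0]_(lam : intpart n | at_most_two_parts lam)
           muln_grepr (specht K lam) (two_row_mult n (part lam 1)))).
Proof.
apply: repr_iso_rsim (regular_bigset_rsim n charK0).
by apply: multilinear_detect; rewrite ?(natK_neq0 charK0).
Qed.
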